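(* Let $j>1$ be an integer and let $f \in L^{2j/(2j-1)}$. If $S$ is the set of frequencies of $f$, then the set of frequencies of the minimal majorant of $f$ in $L^{2j/(2j-1)}$ is included in the algebraic sum of $j$ copies of $S$ and $j-1$ copies of $-S$, that is, in the set of all integers $s_1+\dots+s_j - t_1 - \dots - t_{j-1}$ with all $s_i, t_i \in S$. If $f$ is a trigonometric polynomial, then so is its majorant of minimal norm in $L^{2j/(2j-1)}$.
   Context: $L^p$ denotes the space of complex-valued ($2\pi$-periodic) functions on $[-\pi,\pi)$ with norm $\|f\|_p = \left(\frac{1}{2\pi}\int_{-\pi}^{\pi}|f(\theta)|^p\,d\theta\right)^{1/p}$, and $\hat f(n) = \frac{1}{2\pi}\int_{-\pi}^\pi f(\theta)e^{-in\theta}\,d\theta$ for integers $n$. The set of frequencies of $f$ is the support of $\hat f$, i.e. $\{n \in \mathbb{Z} : \hat f(n) \ne 0\}$. A function $F$ is a majorant of $f$ when $|\hat f(n)| \le \hat F(n)$ for all integers $n$. For $p = 2j/(2j-1)$ with $j>1$ an integer, every $f\in L^p$ has a majorant in $L^p$, and the minimal majorant of $f$ in $L^p$ is the unique majorant of $f$ in $L^p$ of least $L^p$ norm. *)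

(* Defs.v *)
From mathcomp Require Import all_boot all_order all_algebra.
From mathcomp Require Import all_classical all_reals all_analysis.
From mathcomp Require Import complex.

Set Implicit Arguments.
Unset Strict Implicit.
Unset Printing Implicit Defensive.

Import Order.TTheory GRing.Theory Num.Theory.
Local Open Scope classical_set_scope.
Local Open Scope ring_scope.
Local Open Scope complex_scope.

(* A function on the circle is represented by a total function R -> R[i], of
   which only the restriction to [-pi, pi[ is ever used, up to a.e. equality:
   values outside this period are irrelevant, so periodicity is not required. *)
Definition period (R : realType) : set R := `[- pi, pi[.

Definition expi (R : realType) (x : R) : R[i] := cos x +i* sin x.

Definition Cintegral (R : realType) (D : set R) (g : R -> R[i]) : R[i] :=
  (\int[lebesgue_measure]_(x in D) complex.Re (g x))
  +i* (\int[lebesgue_measure]_(x in D) complex.Im (g x)).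

(* [Normc.normc z] is the modulus of z as an element of R. *)
Definition circle_Lnorm (R : realType) (p : R) (f : R -> R[i]) : \bar R :=
  (((2 * pi)^-1)%:E *
   \int[lebesgue_measure]_(x in @period R)
      ((Normc.normc (f x)) `^ p)%:E) `^ p^-1.

Definition in_Lp (R : realType) (p : R) (f : R -> R[i]) : Prop :=
  [/\ measurable_fun (@period R) (fun x => complex.Re (f x)),
      measurable_fun (@period R) (fun x => complex.Im (f x))
    & (circle_Lnorm p f < +oo)%E].

Definition fourier_coef (R : realType) (f : R -> R[i]) (n : int) : R[i] :=
  ((2 * pi)^-1)%:C * Cintegral (@period R) (fun x => f x * expi (- (n%:~R * x))).

Definition frequencies (R : realType) (f : R -> R[i]) : set int :=
  [set n | fourier_coef f n != 0].

(* The order of R[i] compares only numbers with equal imaginary parts, so this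
   inequality also says that every Fourier coefficient of F is real and >= 0. *)
Definition majorant (R : realType) (f F : R -> R[i]) : Prop :=
  forall n : int, `|fourier_coef f n| <= fourier_coef F n.

(* Functions that agree a.e. are not identified, so "the" minimal majorant is a
   predicate on representatives. *)
Definition minimal_majorant (R : realType) (p : R) (f F : R -> R[i]) : Prop :=
  [/\ in_Lp p F, majorant f F
    & forall G : R -> R[i], in_Lp p G -> majorant f G ->
        (circle_Lnorm p F <= circle_Lnorm p G)%E].

(* As for any element of L^p, the equality is only required a.e. *)
Definition trig_polynomial (R : realType) (f : R -> R[i]) : Prop :=
  exists (s : seq int) (c : int -> R[i]),
    {ae lebesgue_measure, forall x : R, @period R x ->
      f x = \sum_(n <- s) c n * expi (n%:~R * x)}.

Definition sum_diff_set (S : set int) (a b : nat) : set int :=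
  [set n | exists (s : 'I_a -> int) (t : 'I_b -> int),
     [/\ forall i, S (s i), forall i, S (t i)
       & n = \sum_(i < a) s i - \sum_(i < b) t i]].

(* Main.v *)
From HB Require Import structures.
Require Import Defs.
From mathcomp Require Import all_boot all_order all_algebra.
From mathcomp Require Import all_classical all_reals all_analysis.
From mathcomp Require Import measurable_realfun.
From mathcomp Require Import ring lra zify.
From mathcomp Require Import complex.

(** Write p = 2j/(2j-1), so that the conjugate exponent is 2j, and let F be the
    minimal majorant of f.  The proof is a duality argument on the function
    K = |F|^(p-2) F, which lies in L^(2j) and determines F through the
    polynomial identity F = K^j conj(K)^(j-1) ([zpow_dual]).

    First-order condition.  The function F + e c exp(inx) is still a majorant of
    f for small e > 0 when c > 0, and also when c < 0 provided that
    |f^(n)| < F^(n).  The derivative of the p-th power of the norm in this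
    direction has the sign of c Re K^(n), and minimality makes it nonnegative
    ([dual_variation]).  Hence Re K^(n) >= 0 for all n, and Re K^(n) = 0 as soon
    as |f^(n)| < F^(n).  The coefficients of F being real, F(-x) = conj F(x)
    almost everywhere; K inherits this symmetry, so that K^(n) is real
    ([dual_coef_real]).

    Convolution.  By the identity above, F^ is the convolution of j copies of K^
    and j-1 copies of its reflection, a sum of nonnegative terms.  The term in
    which every frequency equals n contributes to the frequency
    jn - (j-1)n = n, whence F^(n) >= K^(n)^(2j-1).  Suppose that n is not a
    frequency of f while K^(n) > 0.  Then F^(n) > 0 = |f^(n)|, and the
    first-order condition gives K^(n) = 0, a contradiction.  So all frequencies
    of K are frequencies of f, and the convolution formula places those of F in
    the sum of j copies of S and j-1 copies of -S
    ([frequencies_minimal_majorant]).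

    The infinite convolution is never formed.  K is replaced by its Fejer means,
    which are trigonometric polynomials with nonnegative coefficients and no new
    frequencies; for them the two facts are finite algebra
    ([postrig_coef_zpow], [postrig_zpow]).  The Fejer means converge in L^(2j)
    ([fejer_mean_Lq]), which is just what is needed for the coefficients of
    K^j conj(K)^(j-1) to pass to the limit ([fourier_coef_zpow_cvg]).

    If f is a trigonometric polynomial, S is finite, hence F has finitely many
    frequencies, and the uniqueness of Fourier coefficients (Fejer means again,
    now in L^1) identifies F with the sum of its Fourier series
    ([minimal_majorant_trig]). *)

Import Order.TTheory GRing.Theory Num.Theory.
Import numFieldNormedType.Exports.
Set Implicit Arguments.
Unset Strict Implicit.
Unset Printing Implicit Defensive.
Local Open Scope classical_set_scope.
Local Open Scope ring_scope.
Local Open Scope complex_scope.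

(** The domain is fixed once and for all: every integral below is over one
    period. *)
Notation integ u := ((@lebesgue_measure _).-integrable (@period _) (EFin \o u)).
Notation int_ u := (\int[@lebesgue_measure _]_(x in @period _) u x).

(** * Real integrals over one period *)

Section integrals.
Context {R : realType}.
Local Notation mu := (@lebesgue_measure R).
Local Notation per := (@period R).
Implicit Types u v h : R -> R.

Lemma measurable_period : measurable per.
Proof. exact: measurable_itv. Qed.
Local Hint Resolve measurable_period : core.

Lemma mu_period : mu per = (2 * pi)%:E.
Proof.
rewrite /period lebesgue_measure_itv/= lte_fin gtrN ?pi_gt0//.
by rewrite -EFinB; congr (_%:E); ring.
Qed.

Lemma mu_period_lty : (mu per < +oo)%E.
Proof. by rewrite mu_period ltry. Qed.

Lemma integ_meas u : integ u -> measurable_fun per u.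
Proof. by move=> /integrableP[/measurable_EFinP]. Qed.

Lemma eq_integ u v : (forall x, per x -> u x = v x) -> integ u -> integ v.
Proof.
by move=> uv; apply: eq_integrable => // x /set_mem xP /=; rewrite uv.
Qed.

Lemma eq_int u v : (forall x, per x -> u x = v x) -> int_ u = int_ v.
Proof. by move=> uv; apply: eq_Rintegral => x /set_mem /uv. Qed.

Lemma integ_le u v : measurable_fun per u -> integ v ->
  (forall x, per x -> `|u x| <= v x) -> integ u.
Proof.
move=> meas_u iv uv; apply: (le_integrable _ _ _ iv) => //.
  exact/measurable_EFinP.
by move=> x Px /=; rewrite lee_fin (le_trans (uv x Px))// ler_norm.
Qed.

Lemma integ_cst c : integ (fun=> c : R).
Proof.
apply: measurable_bounded_integrable => //; first exact: mu_period_lty.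
by exists `|c|; split; [exact: num_real|move=> M cM x _ /=; exact: ltW].
Qed.

Lemma int_cst (c : R) : int_ (fun=> c) = c * (2 * pi).
Proof.
rewrite Rintegral_cst//; congr (_ * _).
by rewrite -[RHS]/(fine (2 * pi)%:E) -mu_period.
Qed.

Lemma integ_bdd u M : measurable_fun per u ->
  (forall x, per x -> `|u x| <= M) -> integ u.
Proof. by move=> meas_u uM; apply: integ_le (integ_cst M) uM. Qed.

Lemma integD u v : integ u -> integ v -> integ (fun x => u x + v x).
Proof. by move=> iu iv; apply: (integrableD _ iu iv). Qed.

Lemma integN u : integ u -> integ (fun x => - u x).
Proof. by move=> iu; apply: (integrableN iu). Qed.

Lemma integB u v : integ u -> integ v -> integ (fun x => u x - v x).
Proof. by move=> iu iv; apply: integD => //; exact: integN. Qed.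

Lemma integZ c u : integ u -> integ (fun x => c * u x).
Proof. by move=> iu; apply: (integrableZl _ c iu). Qed.

Lemma integ_norm u : integ u -> integ (fun x => `|u x|).
Proof. exact: integrable_norm. Qed.

Lemma integM u h M : integ u -> measurable_fun per h ->
  (forall x, per x -> `|h x| <= M) -> integ (fun x => u x * h x).
Proof.
move=> iu mh hM; apply: integ_le (integZ M (integ_norm iu)) _.
  by apply: measurable_funM => //; exact: integ_meas.
by move=> x Px; rewrite normrM mulrC ler_wpM2r ?hM.
Qed.

Lemma intD u v : integ u -> integ v ->
  int_ (fun x => u x + v x) = int_ u + int_ v.
Proof. by move=> iu iv; exact: RintegralD. Qed.

Lemma intZ c u : integ u -> int_ (fun x => c * u x) = c * int_ u.
Proof. by move=> iu; exact: RintegralZl. Qed.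

Lemma intB u v : integ u -> integ v ->
  int_ (fun x => u x - v x) = int_ u - int_ v.
Proof. by move=> iu iv; exact: RintegralB. Qed.

Lemma intN u : integ u -> int_ (fun x => - u x) = - int_ u.
Proof.
move=> iu; rewrite -mulN1r -intZ//.
by apply: eq_int => x _; rewrite mulN1r.
Qed.

Lemma le_int u v : integ u -> integ v -> (forall x, per x -> u x <= v x) ->
  int_ u <= int_ v.
Proof. by move=> iu iv; apply: (le_Rintegral _ iu iv). Qed.

Lemma int_ge0 u : (forall x, per x -> 0 <= u x) -> 0 <= int_ u.
Proof. by move=> u0; exact: (@Rintegral_ge0 _ _ R mu). Qed.

Lemma le_norm_int u : integ u -> `|int_ u| <= int_ (fun x => `|u x|).
Proof. by move=> iu; exact: le_normr_Rintegral. Qed.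

Lemma integral_int u : integ u ->
  (\int[mu]_(x in per) (u x)%:E = (int_ u)%:E)%E.
Proof. by move=> iu; rewrite /Rintegral fineK//; exact: integrable_fin_num. Qed.

Lemma ae_imply (Q Q' : R -> Prop) : (forall x, Q x -> Q' x) ->
  {ae mu, forall x, Q x} -> {ae mu, forall x, Q' x}.
Proof.
by move=> QQ'; apply: filterS => //; exact: (ae_filter_ringOfSetsType mu).
Qed.

Lemma ae_imply2 (Q1 Q2 Q' : R -> Prop) : (forall x, Q1 x -> Q2 x -> Q' x) ->
  {ae mu, forall x, Q1 x} -> {ae mu, forall x, Q2 x} -> {ae mu, forall x, Q' x}.
Proof.
by move=> QQ'; apply: filterS2 => //; exact: (ae_filter_ringOfSetsType mu).
Qed.

Lemma ae_eq_int u v : measurable_fun per u -> measurable_fun per v ->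
  {ae mu, forall x, per x -> u x = v x} -> int_ u = int_ v.
Proof.
move=> meas_u mv uv; congr fine; apply: ae_eq_integral => //.
- exact/measurable_EFinP.
- exact/measurable_EFinP.
- by apply: ae_imply uv => x /[swap] Px ->.
Qed.

Lemma int0_ae u : integ u -> int_ (fun x => `|u x|) = 0 ->
  {ae mu, forall x, per x -> u x = 0}.
Proof.
move=> iu u0; have meas_u := integ_meas iu.
have : (\int[mu]_(x in per) `|(EFin \o u) x| = 0)%E.
  by rewrite (integral_int (integ_norm iu)) u0.
have mu' : measurable_fun per (EFin \o u) by exact/measurable_EFinP.
move=> /(ae_eq_integral_abs mu (measurable_itv _) mu').
by apply: ae_imply => x h Px; have /= := h Px; case.
Qed.

Lemma int_dominated (u_ : nat -> R -> R) u v :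
  (forall n, measurable_fun per (u_ n)) -> measurable_fun per u ->
  integ v -> (forall n x, per x -> `|u_ n x| <= v x) ->
  {ae mu, forall x, per x -> u_ n x @[n --> \oo] --> u x} ->
  int_ (u_ n) @[n --> \oo] --> int_ u.
Proof.
move=> mun meas_u iv le_uv cvu.
have c1 n : measurable_fun per (EFin \o u_ n).
  by apply/measurable_EFinP; exact: mun.
have c2 : measurable_fun per (EFin \o u) by exact/measurable_EFinP.
have c3 : {ae mu, forall x, per x -> (EFin \o u_ n) x @[n --> \oo] --> (EFin \o u) x}.
  by apply: ae_imply cvu => x h Px /=; apply: cvg_EFin; [exact: nearW|exact: h].
have c4 : {ae mu, forall x n, per x -> (`|(EFin \o u_ n) x| <= (EFin \o v) x)%E}.
  by apply: aeW => x n Px /=; rewrite lee_fin le_uv.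
have [iu _ cu] := @dominated_convergence _ _ R mu per (measurable_itv _)
  _ _ _ c1 c2 c3 iv c4.
have iun n : integ (u_ n) by apply: integ_le iv _ => // x; exact: le_uv.
have fu : (\int[mu]_(x in per) (EFin \o u) x)%E \is a fin_num.
  exact: integrable_fin_num.
rewrite -(fineK fu) in cu.
by move/fine_cvg : cu.
Qed.

End integrals.
#[global] Hint Resolve measurable_period : core.

(** * The characters of the circle *)

Section circle_characters.
Context {R : realType}.
Local Notation per := (@period R).
Implicit Types (n m : int) (x y : R).

Lemma expi0 : expi (0 : R) = 1.
Proof. by rewrite /expi cos0 sin0. Qed.

Lemma expiD x y : expi (x + y) = expi x * expi y.
Proof.
by rewrite /expi cosD sinD; apply/eqP; rewrite eq_complex/= eqxx addrC eqxx.
Qed.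

Lemma expiN x : expi (- x) = conjc (expi x).
Proof. by rewrite /expi cosN sinN. Qed.

Lemma normc_expi x : Normc.normc (expi x) = 1.
Proof. by rewrite /= cos2Dsin2 sqrtr1. Qed.

Definition echar (n : int) (x : R) : R[i] := expi (n%:~R * x).

Lemma echar0 x : echar 0 x = 1.
Proof. by rewrite /echar mul0r expi0. Qed.

Lemma echarD n m x : echar (n + m) x = echar n x * echar m x.
Proof. by rewrite /echar rmorphD/= mulrDl expiD. Qed.

Lemma echarN n x : echar (- n) x = conjc (echar n x).
Proof. by rewrite /echar rmorphN/= mulNr expiN. Qed.

Lemma echarB n x y : echar n (x - y) = echar n x * echar (- n) y.
Proof. by rewrite /echar mulrBr expiD rmorphN/= mulNr. Qed.

Lemma normc_echar n x : Normc.normc (echar n x) = 1.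
Proof. exact: normc_expi. Qed.

Lemma continuous_cosn (a : R) : continuous (fun x : R => cos (a * x)).
Proof.
move=> x; apply: (@continuous_comp _ _ _ (fun y => a * y) cos); last first.
  exact: continuous_cos.
by apply: cvgMr; exact: cvg_id.
Qed.

Lemma continuous_sinn (a : R) : continuous (fun x : R => sin (a * x)).
Proof.
move=> x; apply: (@continuous_comp _ _ _ (fun y => a * y) sin); last first.
  exact: continuous_sin.
by apply: cvgMr; exact: cvg_id.
Qed.

Lemma measurable_cosn (a : R) D : measurable_fun D (fun x : R => cos (a * x)).
Proof.
apply: measurable_funTS; apply: continuous_measurable_fun.
exact: continuous_cosn.
Qed.

Lemma measurable_sinn (a : R) D : measurable_fun D (fun x : R => sin (a * x)).
Proof.
apply: measurable_funTS; apply: continuous_measurable_fun.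
exact: continuous_sinn.
Qed.

Lemma norm_cos_le1 x : `|cos x| <= 1.
Proof. by rewrite ler_norml cos_geN1 cos_le1. Qed.

Lemma norm_sin_le1 x : `|sin x| <= 1.
Proof. by rewrite ler_norml sin_geN1 sin_le1. Qed.

Lemma integ_Mcosn (u : R -> R) a : integ u -> integ (fun x => u x * cos (a * x)).
Proof.
move=> iu; by apply: (integM (M := 1) iu) => [|x _]; [exact: measurable_cosn|exact: norm_cos_le1].
Qed.

Lemma integ_Msinn (u : R -> R) a : integ u -> integ (fun x => u x * sin (a * x)).
Proof.
move=> iu; by apply: (integM (M := 1) iu) => [|x _]; [exact: measurable_sinn|exact: norm_sin_le1].
Qed.

Lemma integ_cosn (a : R) : integ (fun x => cos (a * x)).
Proof.
by apply: (@integ_bdd _ _ 1) => [|x _]; [exact: measurable_cosn|exact: norm_cos_le1].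
Qed.

Lemma integ_sinn (a : R) : integ (fun x => sin (a * x)).
Proof.
by apply: (@integ_bdd _ _ 1) => [|x _]; [exact: measurable_sinn|exact: norm_sin_le1].
Qed.

(** Closing the half-open period changes no integral, so the fundamental theorem
    for closed intervals applies. *)
Lemma int_FTC (f F : R -> R) : continuous f ->
  (forall x, is_derive x 1 F (f x)) -> integ f -> int_ f = F pi - F (- pi).
Proof.
move=> cf dF iF; have pi0 : - pi < pi :> R by rewrite gtrN ?pi_gt0.
rewrite Rintegral_itv_bndo_bndc// /Rintegral.
have cF : continuous F by move=> x; apply/differentiable_continuous/derivable1_diffP; case: (dF x).
rewrite (@continuous_FTC2 _ _ F)//.
- exact: continuous_subspaceT.
- split.
  + by move=> x _; case: (dF x).
  + by apply: cvg_at_right_filter; exact: cF.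
  + by apply: cvg_at_left_filter; exact: cF.
- by move=> x _; rewrite derive1E; case: (dF x).
Qed.

Lemma int_cosn n : int_ (fun x : R => cos (n%:~R * x)) =
  if n == 0 then 2 * pi else 0.
Proof.
case: eqP => [->|/eqP n0].
  rewrite (eq_int (v := fun=> 1)) ?int_cst ?mul1r// => x _.
  by rewrite mul0r cos0.
have n0' : n%:~R != 0 :> R by rewrite intr_eq0.
have d x : is_derive x 1 (fun x => n%:~R^-1 * sin (n%:~R * x)) (cos (n%:~R * x)).
  by apply: is_derive_eq; rewrite /GRing.scale/=; field.
rewrite (int_FTC (@continuous_cosn n%:~R) d (integ_cosn _)).
rewrite mulrN sinN mulrN opprK.
suff -> : sin (n%:~R * pi) = 0 :> R by rewrite mulr0 addr0.
have sk (k : nat) : sin (k%:R * pi) = 0 :> R.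
  by elim: k => [|k IH]; rewrite ?mul0r ?sin0// -natr1 mulrDl mul1r sinDpi IH oppr0.
case: n {n0 n0' d} => n; first exact: sk.
by rewrite NegzE rmorphN/= mulNr sinN sk oppr0.
Qed.

Lemma int_sinn (a : R) : int_ (fun x : R => sin (a * x)) = 0.
Proof.
have [->|a0] := eqVneq a 0.
  rewrite (eq_int (v := fun=> 0)) ?int_cst ?mul0r// => x _.
  by rewrite mul0r sin0.
have d x : is_derive x 1 (fun x => - a^-1 * cos (a * x)) (sin (a * x)).
  by apply: is_derive_eq; rewrite /GRing.scale/=; field.
rewrite (int_FTC (@continuous_sinn a) d (integ_sinn _)).
by rewrite mulrN cosN subrr.
Qed.

End circle_characters.

(** * Complex integrals and Fourier coefficients *)

Section complex_integrals.
Context {R : realType}.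
Local Notation mu := (@lebesgue_measure R).
Local Notation per := (@period R).
Local Notation Re := (@complex.Re R).
Local Notation Im := (@complex.Im R).
Local Notation Cint g := (Cintegral per g).
Implicit Types (f g : R -> R[i]) (c z w : R[i]) (n m : int).

Lemma cReD z w : Re (z + w) = Re z + Re w. Proof. by case: z; case: w. Qed.
Lemma cImD z w : Im (z + w) = Im z + Im w. Proof. by case: z; case: w. Qed.
Lemma cReM z w : Re (z * w) = Re z * Re w - Im z * Im w.
Proof. by case: z; case: w. Qed.
Lemma cImM z w : Im (z * w) = Re z * Im w + Im z * Re w.
Proof. by case: z; case: w. Qed.

Lemma complex_ext z w : Re z = Re w -> Im z = Im w -> z = w.
Proof. by case: z => a b; case: w => ? ? /= -> ->. Qed.

Definition Cinteg g := integ (Re \o g) /\ integ (Im \o g).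

Lemma eq_Cint f g : (forall x, per x -> f x = g x) -> Cint f = Cint g.
Proof. by move=> fg; congr (_ +i* _); apply: eq_int => x /fg ->. Qed.

Lemma eq_Cinteg f g : (forall x, per x -> f x = g x) -> Cinteg f -> Cinteg g.
Proof.
by move=> fg [h k]; split; [apply: eq_integ h|apply: eq_integ k] => x /fg /= ->.
Qed.

Lemma CintegD f g : Cinteg f -> Cinteg g -> Cinteg (fun x => f x + g x).
Proof.
move=> [f1 f2] [g1 g2]; split.
  by apply: eq_integ (integD f1 g1) => x _ /=; rewrite cReD.
by apply: eq_integ (integD f2 g2) => x _ /=; rewrite cImD.
Qed.

Lemma CintD f g : Cinteg f -> Cinteg g ->
  Cint (fun x => f x + g x) = Cint f + Cint g.
Proof.
move=> [f1 f2] [g1 g2]; apply: complex_ext; rewrite ?cReD ?cImD /= -intD//; apply: eq_int => x _.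
  by rewrite cReD.
by rewrite cImD.
Qed.

Lemma CintegZ c f : Cinteg f -> Cinteg (fun x => c * f x).
Proof.
move=> [f1 f2]; split.
  apply: eq_integ (integB (integZ (Re c) f1) (integZ (Im c) f2)) => x _ /=.
  by rewrite cReM.
apply: eq_integ (integD (integZ (Re c) f2) (integZ (Im c) f1)) => x _ /=.
by rewrite cImM.
Qed.

Lemma CintZ c f : Cinteg f -> Cint (fun x => c * f x) = c * Cint f.
Proof.
move=> [f1 f2]; apply: complex_ext; rewrite ?cReM ?cImM /=.
  rewrite -!intZ// -intB//; try exact: integZ.
  by apply: eq_int => x _ /=; rewrite cReM.
rewrite -!intZ// -intD//; try exact: integZ.
by apply: eq_int => x _ /=; rewrite cImM.
Qed.

Lemma Cinteg0 : Cinteg (fun=> 0).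
Proof. by split; exact: integ_cst. Qed.

Lemma Cinteg_sum (I : Type) (s : seq I) (F : I -> R -> R[i]) :
  (forall i, Cinteg (F i)) -> Cinteg (fun x => \sum_(i <- s) F i x).
Proof.
move=> iF; elim: s => [|i s IH].
  by apply: eq_Cinteg Cinteg0 => x _; rewrite big_nil.
by apply: eq_Cinteg (CintegD (iF i) IH) => x _; rewrite big_cons.
Qed.

Lemma Cint_sum (I : Type) (s : seq I) (F : I -> R -> R[i]) :
  (forall i, Cinteg (F i)) ->
  Cint (fun x => \sum_(i <- s) F i x) = \sum_(i <- s) Cint (F i).
Proof.
move=> iF; elim: s => [|i s IH].
  rewrite big_nil (eq_Cint (g := fun=> 0)) => [|x _]; last by rewrite big_nil.
  by apply: complex_ext => /=; rewrite int_cst mul0r.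
rewrite big_cons -IH -CintD//; last exact: Cinteg_sum.
by apply: eq_Cint => x _; rewrite big_cons.
Qed.

Lemma Cinteg_echar n : Cinteg (echar n).
Proof. by split; [exact: integ_cosn|exact: integ_sinn]. Qed.

Lemma Cint_echar n : Cint (echar n) = if n == 0 then (2 * pi)%:C else 0.
Proof.
by apply: complex_ext; rewrite /= ?int_cosn ?int_sinn; case: eqP.
Qed.

Lemma CintegMechar g n : Cinteg g -> Cinteg (fun x => g x * echar n x).
Proof.
move=> [g1 g2]; split.
  apply: eq_integ (integB (integ_Mcosn n%:~R g1) (integ_Msinn n%:~R g2)) => x _ /=.
  by rewrite cReM.
apply: eq_integ (integD (integ_Msinn n%:~R g1) (integ_Mcosn n%:~R g2)) => x _ /=.
by rewrite cImM.
Qed.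

Lemma Cinteg_real (u : R -> R) : integ u -> Cinteg (fun x => (u x)%:C).
Proof. by move=> iu; split => //; exact: integ_cst. Qed.

Lemma Cint_real (u : R -> R) : Cint (fun x => (u x)%:C) = (int_ u)%:C.
Proof. by apply: complex_ext => //=; rewrite int_cst mul0r. Qed.

Lemma pi2_neq0 : 2 * pi != 0 :> R.
Proof. by rewrite mulf_neq0// gt_eqF// pi_gt0. Qed.

Lemma pi2_gt0 : 0 < 2 * pi :> R.
Proof. by rewrite mulr_gt0// pi_gt0. Qed.

Lemma fourier_coefE f n : fourier_coef f n =
  ((2 * pi)^-1)%:C * Cint (fun x => f x * echar (- n) x).
Proof. by congr (_ * _); apply: eq_Cint => x _; rewrite /echar rmorphN mulNr. Qed.

Lemma fourier_coefD f g n : Cinteg f -> Cinteg g ->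
  fourier_coef (fun x => f x + g x) n = fourier_coef f n + fourier_coef g n.
Proof.
move=> fi gi; rewrite !fourier_coefE -mulrDr -CintD; try exact: CintegMechar.
by congr (_ * _); apply: eq_Cint => x _; rewrite mulrDl.
Qed.

Lemma fourier_coefZ c f n : Cinteg f ->
  fourier_coef (fun x => c * f x) n = c * fourier_coef f n.
Proof.
move=> fi; rewrite !fourier_coefE mulrCA -(CintZ c (CintegMechar _ fi)).
by congr (_ * _); apply: eq_Cint => x _; rewrite mulrA.
Qed.

Lemma fourier_coef_echar m n : fourier_coef (@echar R m) n = (m == n)%:R.
Proof.
rewrite fourier_coefE (eq_Cint (g := echar (m - n))) => [|x _]; last by rewrite echarD.
rewrite Cint_echar subr_eq0; case: eqP => _; last by rewrite mulr0.
by rewrite -rmorphM/= mulVf ?pi2_neq0.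
Qed.

Lemma fourier_coef_sum (I : Type) (s : seq I) (F : I -> R -> R[i]) n :
  (forall i, Cinteg (F i)) ->
  fourier_coef (fun x => \sum_(i <- s) F i x) n = \sum_(i <- s) fourier_coef (F i) n.
Proof.
move=> iF; under [RHS]eq_bigr do rewrite fourier_coefE.
rewrite fourier_coefE -mulr_sumr -Cint_sum => [|i]; last by exact: CintegMechar.
by congr (_ * _); apply: eq_Cint => x _; rewrite mulr_suml.
Qed.

Lemma Cinteg_trig (I : Type) (s : seq I) (c : I -> R[i]) (k : I -> int) :
  Cinteg (fun x => \sum_(i <- s) c i * echar (k i) x).
Proof. by apply: Cinteg_sum => i; apply: CintegZ; exact: Cinteg_echar. Qed.

Lemma fourier_coef_trig (I : Type) (s : seq I) (c : I -> R[i]) (k : I -> int) n :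
  fourier_coef (fun x => \sum_(i <- s) c i * echar (k i) x) n =
  \sum_(i <- s | k i == n) c i.
Proof.
rewrite fourier_coef_sum => [|i]; last by apply: CintegZ; exact: Cinteg_echar.
rewrite [RHS]big_mkcond; apply: eq_bigr => i _.
rewrite fourier_coefZ; last exact: Cinteg_echar.
by rewrite fourier_coef_echar; case: eqP; rewrite ?mulr1 ?mulr0.
Qed.

Lemma fourier_coef0 f : fourier_coef f 0 = ((2 * pi)^-1)%:C * Cint f.
Proof.
by rewrite fourier_coefE oppr0; congr (_ * _); apply: eq_Cint => x _; rewrite echar0 mulr1.
Qed.

Lemma Cinteg_meas f : Cinteg f ->
  measurable_fun per (Re \o f) /\ measurable_fun per (Im \o f).
Proof. by move=> [/integ_meas ? /integ_meas]. Qed.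

Lemma ae_eq_fourier_coef f g n : Cinteg f -> Cinteg g ->
  {ae mu, forall x, per x -> f x = g x} -> fourier_coef f n = fourier_coef g n.
Proof.
move=> fi gi fg; rewrite !fourier_coefE; congr (_ * _).
have [f1 f2] := Cinteg_meas (CintegMechar (- n) fi).
have [g1 g2] := Cinteg_meas (CintegMechar (- n) gi).
by congr (_ +i* _); apply: ae_eq_int => //; apply: ae_imply fg => x /[swap] Px -> //.
Qed.

End complex_integrals.

(** * The Fejer kernel and the contraction property of Fejer means *)

Section fejer.
Context {R : realType}.
Local Notation per := (@period R).
Local Notation Re := (@complex.Re R).
Local Notation Im := (@complex.Im R).
Local Notation Cint g := (Cintegral per g).
Implicit Types (N : nat) (u v : R -> R) (h : R -> R[i]) (x t : R).

Definition dirichlet N x : R[i] := \sum_(k < N) echar k%:Z x.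
(** A squared modulus, so that positivity is immediate and the kernel expands
    into finitely many characters. *)
Definition fejer N x : R := N%:R^-1 * Normc.normc (dirichlet N x) ^+ 2.
Definition fejer_mean N u x : R := (2 * pi)^-1 * int_ (fun t => u t * fejer N (x - t)).
Definition freq N (p : 'I_N * 'I_N) : int := p.1%:Z - p.2%:Z.
(** The Fejer mean of a complex function, as a trigonometric polynomial: the
    frequency n occurs once for each pair (k, l) with k - l = n, which produces
    the usual weight 1 - |n|/N without having to count these pairs. *)
Definition fejer_meanC N h x : R[i] :=
  \sum_(p : 'I_N * 'I_N) (N%:R^-1)%:C * fourier_coef h (freq p) * echar (freq p) x.

Lemma fejer_ge0 N x : 0 <= fejer N x.
Proof. by rewrite mulr_ge0 ?invr_ge0 ?sqr_ge0. Qed.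

Lemma normc_sqr (z : R[i]) : (Normc.normc z ^+ 2)%:C = z * conjc z.
Proof. by rewrite rmorphXn/= -(sqr_normc z). Qed.

(** The squared modulus of a sum of characters is the double sum of their
    quotients. *)
Lemma fejerC N x : (fejer N x)%:C =
  \sum_(p : 'I_N * 'I_N) (N%:R^-1)%:C * echar (freq p) x.
Proof.
rewrite /fejer rmorphM/= normc_sqr -mulr_sumr; congr (_ * _).
rewrite /dirichlet rmorph_sum/= big_distrlr/= pair_big/=; apply: eq_bigr => p _.
by rewrite [X in _ * X](_ : _ = echar (- p.2%:Z) x) -?echarD// echarN.
Qed.

Lemma fejer_cos N x : fejer N x =
  \sum_(p : 'I_N * 'I_N) N%:R^-1 * cos ((freq p)%:~R * x).
Proof.
have /(congr1 Re)/= -> := fejerC N x.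
rewrite (big_morph Re (@cReD R) (erefl : Re 0 = 0)).
by apply: eq_bigr => p _; rewrite cReM/= mul0r subr0.
Qed.

Lemma fejer_le N x : fejer N x <= \sum_(p : 'I_N * 'I_N) N%:R^-1.
Proof.
rewrite fejer_cos; apply: ler_sum => p _.
by rewrite ler_piMr ?cos_le1// invr_ge0.
Qed.

Lemma measurable_fejerB N x : measurable_fun per (fun t => fejer N (x - t)).
Proof.
have -> : (fun t => fejer N (x - t)) = (fun t => \sum_(p : 'I_N * 'I_N)
    (N%:R^-1 * cos ((freq p)%:~R * x) * cos ((freq p)%:~R * t)
     + N%:R^-1 * sin ((freq p)%:~R * x) * sin ((freq p)%:~R * t))).
  apply/funext => t; rewrite fejer_cos; apply: eq_bigr => p _.
  by rewrite mulrBr cosB mulrDr !mulrA.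
apply: measurable_sum => p; apply: measurable_funD; apply: measurable_funM => //.
  exact: measurable_cosn.
exact: measurable_sinn.
Qed.

Lemma integMfejer N u x : integ u -> integ (fun t => u t * fejer N (x - t)).
Proof.
move=> iu; apply: (integM iu (measurable_fejerB N x)) => t _.
by rewrite ger0_norm ?fejer_ge0//; exact: fejer_le.
Qed.

(** Since the kernel has finite rank, integrating it against h is a finite sum of
    Fourier coefficients: the integral operator (used for estimates) and the
    polynomial (used for algebra) are the same object. *)
Lemma fejer_meanCE N h x : Cinteg h ->
  fejer_meanC N h x = fejer_mean N (Re \o h) x +i* fejer_mean N (Im \o h) x.
Proof.
move=> ih.
transitivity (((2 * pi)^-1)%:C * Cint (fun t => h t * (fejer N (x - t))%:C)); last first.
  rewrite /fejer_mean; apply: complex_ext; rewrite ?cReM ?cImM/= mul0r ?subr0 ?addr0.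
    congr (_ * _); apply: eq_int => t _ /=.
    by rewrite cReM/= mulr0 subr0.
  congr (_ * _); apply: eq_int => t _ /=.
  by rewrite cImM/= mulr0 add0r.
rewrite (eq_Cint (g := fun t => \sum_(p : 'I_N * 'I_N)
  ((N%:R^-1)%:C * echar (freq p) x) * (h t * echar (- freq p) t))); last first.
  move=> t _; rewrite fejerC mulr_sumr; apply: eq_bigr => p _.
  rewrite echarB; ring.
rewrite Cint_sum => [|p]; last by apply: CintegZ; exact: CintegMechar.
rewrite mulr_sumr; apply: eq_bigr => p _.
rewrite CintZ; last by exact: CintegMechar.
rewrite fourier_coefE; ring.
Qed.

Lemma fejer_mean_real N u x : integ u -> (fejer_mean N u x)%:C = fejer_meanC N (fun t => (u t)%:C) x.
Proof.
move=> iu; rewrite fejer_meanCE; last exact: Cinteg_real.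
congr (_ +i* _); rewrite /fejer_mean (eq_int (v := fun=> 0)) ?int_cst ?mul0r ?mulr0// => t _ /=.
by rewrite mul0r.
Qed.

Lemma fourier_coef_fejer_meanC N h n : fourier_coef (fejer_meanC N h) n =
  \sum_(p : 'I_N * 'I_N | freq p == n) (N%:R^-1)%:C * fourier_coef h n.
Proof.
rewrite /fejer_meanC fourier_coef_trig; apply: eq_bigr => p /eqP -> //.
Qed.

Lemma freq_eq0 N (p : 'I_N * 'I_N) : (freq p == 0) = (p.1 == p.2).
Proof. by rewrite subr_eq0. Qed.

Lemma sum_diag N (c : R[i]) : (0 < N)%N ->
  \sum_(p : 'I_N * 'I_N | freq p == 0) (N%:R^-1)%:C * c = c.
Proof.
move=> N0; under eq_bigl do rewrite freq_eq0 eq_sym.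
rewrite (eq_bigl (fun p : 'I_N * 'I_N => true && (p.2 == p.1)))//.
rewrite -(pair_big_dep predT (fun i j : 'I_N => j == i) (fun _ _ => (N%:R^-1)%:C * c))/=.
under eq_bigr do rewrite big_pred1_eq.
rewrite sumr_const card_ord -[LHS]mulr_natl mulrA.
by rewrite fmorphV/= rmorph_nat mulfV ?mul1r// pnatr_eq0 -lt0n.
Qed.

Lemma integ_fejer_mean N u : integ u -> integ (fejer_mean N u).
Proof.
move=> iu; have [h _] := Cinteg_trig (index_enum _) (fun p : 'I_N * 'I_N =>
  (N%:R^-1)%:C * fourier_coef (fun t => (u t)%:C) (freq p)) (@freq N).
apply: eq_integ h => x _; rewrite /= -/(fejer_meanC N _ x) -fejer_mean_real//.
Qed.

(** The mean value of a trigonometric polynomial is its coefficient at 0, and the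
    coefficient of the Fejer mean at 0 is that of u. *)
Lemma int_fejer_mean N u : (0 < N)%N -> integ u -> int_ (fejer_mean N u) = int_ u.
Proof.
move=> N0 iu; apply: complexI; rewrite -!Cint_real.
rewrite (eq_Cint (g := fejer_meanC N (fun t => (u t)%:C))) => [|x _]; last exact: fejer_mean_real.
have := fourier_coef_fejer_meanC N (fun t => (u t)%:C) 0; rewrite sum_diag// !fourier_coef0.
apply: mulfI; rewrite fmorph_eq0 invr_eq0; exact: pi2_neq0.
Qed.

Lemma fejer_mean_cst N (c : R) x : (0 < N)%N -> fejer_mean N (fun=> c) x = c.
Proof.
move=> N0; apply: complexI; rewrite fejer_mean_real; last exact: integ_cst.
rewrite /fejer_meanC -[RHS](sum_diag _ N0) [RHS]big_mkcond/=; apply: eq_bigr => p _.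
have -> : fourier_coef (fun=> c%:C) (freq p) = c%:C * (freq p == 0)%:R.
  rewrite eq_sym -fourier_coef_echar -fourier_coefZ; last exact: Cinteg_echar.
  by rewrite !fourier_coefE; congr (_ * _); apply: eq_Cint => t _; rewrite echar0 mulr1.
by case: eqP => [->|_]; rewrite ?echar0 ?mulr1// !mulr0 mul0r.
Qed.

Lemma fejer_meanD N u v x : integ u -> integ v ->
  fejer_mean N (fun t => u t + v t) x = fejer_mean N u x + fejer_mean N v x.
Proof.
move=> iu iv; rewrite /fejer_mean -mulrDr -intD; try exact: integMfejer.
by congr (_ * _); apply: eq_int => t _; rewrite mulrDl.
Qed.

Lemma fejer_meanZ N c u x : integ u -> fejer_mean N (fun t => c * u t) x = c * fejer_mean N u x.
Proof.
move=> iu; rewrite /fejer_mean mulrCA -(intZ c (integMfejer N x iu)).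
by congr (_ * _); apply: eq_int => t _; rewrite mulrA.
Qed.

Lemma fejer_meanB N u v x : integ u -> integ v ->
  fejer_mean N (fun t => u t - v t) x = fejer_mean N u x - fejer_mean N v x.
Proof.
move=> iu iv; rewrite /fejer_mean -mulrBr -intB; try exact: integMfejer.
by congr (_ * _); apply: eq_int => t _; rewrite mulrBl.
Qed.

Lemma le_fejer_mean N u v x : integ u -> integ v ->
  (forall t, per t -> u t <= v t) -> fejer_mean N u x <= fejer_mean N v x.
Proof.
move=> iu iv uv; rewrite ler_pM2l ?invr_gt0 ?pi2_gt0//.
apply: le_int => [||t Pt]; try exact: integMfejer.
by rewrite ler_wpM2r ?fejer_ge0 ?uv.
Qed.

Lemma bernoulli_tangent q (a b : R) : 0 <= a -> 0 <= b ->
  a ^+ q.+1 + q.+1%:R * a ^+ q * (b - a) <= b ^+ q.+1.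
Proof.
move=> a0 b0; elim: q => [|q IH]; first by rewrite expr0 !expr1; lra.
rewrite [leRHS]exprS; apply: le_trans (ler_wpM2l b0 IH).
rewrite -subr_ge0 (_ : _ - _ = q.+1%:R * a ^+ q * (b - a) ^+ 2).
  by apply: mulr_ge0; [rewrite mulr_ge0 ?exprn_ge0|exact: sqr_ge0].
rewrite -[in X in X * a ^+ q.+1]natr1 !exprS; ring.
Qed.

(** The slope is (q+1) |a|^q sgn(a); since sgn(a) b <= |b|, the inequality reduces
    to the one between |a| and |b|. *)
Lemma norm_pow_tangent q (a : R) :
  exists c, forall b, `|a| ^+ q.+1 + c * (b - a) <= `|b| ^+ q.+1.
Proof.
exists (q.+1%:R * `|a| ^+ q * Num.sg a) => b.
apply: le_trans (bernoulli_tangent q (normr_ge0 a) (normr_ge0 b)).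
rewrite lerD2l -[X in X <= _]mulrA ler_wpM2l ?mulr_ge0// ?exprn_ge0//.
rewrite mulrBr -[X in _ - X]normrEsg lerB//.
apply: le_trans (ler_norm _) _; rewrite normrM ler_piMl//.
by rewrite normr_sg; case: eqP.
Qed.

(** Averaging the tangent inequality at a = (Fejer mean of u at x) kills the
    linear term, the kernel being a probability density. *)
Lemma fejer_mean_jensen N q u x : (0 < N)%N -> integ u ->
  integ (fun t => `|u t| ^+ q.+1) ->
  `|fejer_mean N u x| ^+ q.+1 <= fejer_mean N (fun t => `|u t| ^+ q.+1) x.
Proof.
move=> N0 iu iuq; have [c hc] := norm_pow_tangent q (fejer_mean N u x).
set a := fejer_mean N u x in hc *.
have iua := integB iu (integ_cst a).
have ic := integZ c iua.
have <- : fejer_mean N (fun t => `|a| ^+ q.+1 + c * (u t - a)) x = `|a| ^+ q.+1.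
  rewrite fejer_meanD//; last exact: integ_cst.
  rewrite fejer_meanZ// fejer_meanB//; last exact: integ_cst.
  by rewrite !fejer_mean_cst// -/a subrr mulr0 addr0.
by apply: le_fejer_mean => //; apply: integD => //; exact: integ_cst.
Qed.

(** Jensen at each point, and then preservation of the integral. *)
Lemma fejer_mean_contraction N q u : (0 < N)%N -> integ u ->
  integ (fun t => `|u t| ^+ q.+1) ->
  integ (fun t => `|fejer_mean N u t| ^+ q.+1) /\
  int_ (fun t => `|fejer_mean N u t| ^+ q.+1) <= int_ (fun t => `|u t| ^+ q.+1).
Proof.
move=> N0 iu iuq.
have i : integ (fun t => `|fejer_mean N u t| ^+ q.+1).
  apply: integ_le (integ_fejer_mean N iuq) _ => [|t _].
    apply: measurable_funX; apply: measurableT_comp => //.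
    exact: integ_meas (integ_fejer_mean N iu).
  by rewrite ger0_norm ?exprn_ge0//; exact: fejer_mean_jensen.
split => //; rewrite -[leRHS](int_fejer_mean N0)//.
by apply: le_int => //; [exact: integ_fejer_mean|move=> t _; exact: fejer_mean_jensen].
Qed.

End fejer.

(** * Fejer means of continuous functions *)

Section concentration.
Context {R : realType}.
Local Notation mu := (@lebesgue_measure R).
Local Notation per := (@period R).
Implicit Types (N q : nat) (u v g : R -> R) (x t : R).

Lemma normc_sqrE (z : R[i]) :
  Normc.normc z ^+ 2 = complex.Re z ^+ 2 + complex.Im z ^+ 2.
Proof. by case: z => a b /=; rewrite sqr_sqrtr// addr_ge0 ?sqr_ge0. Qed.

(** A geometric sum. *)
Lemma dirichletE N x : (echar 1 x - 1) * dirichlet N x = echar N%:Z x - 1.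
Proof.
have eX k : echar k%:Z x = echar 1 x ^+ k.
  elim: k => [|k IH]; first by rewrite echar0 expr0.
  by rewrite exprS -IH -echarD.
rewrite eX subrX1; congr (_ * _); apply: eq_bigr => k _; exact: eX.
Qed.

Lemma normc_echarB1 n x : Normc.normc (echar n x - 1) ^+ 2 = 2 * (1 - cos (n%:~R * x)).
Proof.
rewrite normc_sqrE /= subr0 sqrrB1 addrAC -!addrA.
have := cos2Dsin2 (n%:~R * x : R); set a := cos _; set b := sin _; move=> ab.
by rewrite (_ : a ^+ 2 = 1 - b ^+ 2); [ring|rewrite -ab; ring].
Qed.

(** Multiplying the geometric sum by z - 1 leaves a number of modulus at most 2;
    away from multiples of 2 pi the kernel is therefore O(1/N). *)
Lemma fejer_decay N x : (0 < N)%N -> fejer N x * (1 - cos x) <= N%:R^-1 * 2.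
Proof.
move=> N0; rewrite /fejer -mulrA ler_wpM2l ?invr_ge0//.
have /(congr1 (fun z => Normc.normc z ^+ 2)) := dirichletE N x.
rewrite Normc.normcM exprMn !normc_echarB1 mul1r => e.
have := cos_geN1 (N%:~R * x : R).
set d := Normc.normc _ ^+ 2 in e *; nra.
Qed.

(** On [d, 2 pi - d] the cosine is at most its value at the endpoints.  The
    difference of two points of a period may exceed pi, so the decreasing branch
    alone does not suffice. *)
Lemma cos_gap (d y : R) : 0 <= d -> d <= pi -> d <= `|y| -> `|y| <= 2 * pi - d ->
  cos y <= cos d.
Proof.
move=> d0 dpi dy yd; have -> : cos y = cos `|y|.
  by case: (ger0P y) => //; rewrite cosN.
have dI : d \in `[0, pi] by rewrite in_itv/= d0 dpi.
have [ypi|ypi] := leP `|y| pi.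
  by rewrite leNgt ltr_cos// ?in_itv/= ?normr_ge0// -leNgt.
have -> : cos `|y| = cos (2 * pi - `|y|).
  rewrite (_ : 2 * pi - `|y| = - `|y| + pi + pi); last by ring.
  by rewrite !cosDpi opprK cosN.
have yI : 2 * pi - `|y| \in `[0, pi] by rewrite in_itv/=; apply/andP; split; lra.
by rewrite leNgt ltr_cos// -leNgt; lra.
Qed.

Lemma cos_lt1_gap (d : R) : 0 < d -> d <= pi -> cos d < 1.
Proof.
by move=> d0 dpi; rewrite -cos0 ltr_cos// in_itv/= ?lexx ?pi_ge0// (ltW d0).
Qed.

Lemma continuous_meas g : continuous g -> measurable_fun per g.
Proof.
by move=> cg; apply: measurable_funTS; exact: continuous_measurable_fun.
Qed.

Lemma continuous_bdd g : continuous g ->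
  exists2 M, 0 <= M & forall t, per t -> `|g t| <= M.
Proof.
move=> cg; have pipi : - pi <= pi :> R by rewrite ge0_cp// pi_ge0.
have cng : {within `[- pi, pi], continuous (fun t => `|g t|)}.
  by apply: continuous_subspaceT => t; apply: cvg_norm; exact: cg.
have [c _ hc] := EVT_max pipi cng; exists `|g c| => // t.
by rewrite /period /= in_itv/= => /andP[a b]; apply: hc; rewrite in_itv/= a ltW.
Qed.

Lemma continuous_integ g : continuous g -> integ g.
Proof.
move=> cg; have [M _ gM] := continuous_bdd cg.
by apply: integ_bdd gM; exact: continuous_meas.
Qed.

Lemma fejer_mean_bdd N g M : (0 < N)%N -> integ g -> (forall t, per t -> `|g t| <= M) ->
  forall x, `|fejer_mean N g x| <= M.
Proof.
move=> N0 ig gM x; have h := integ_cst M.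
rewrite ler_norml -[in X in X && _](fejer_mean_cst (- M) x N0) -[in X in _ && X](fejer_mean_cst M x N0).
by apply/andP; split; apply: le_fejer_mean => //; try exact: integ_cst; move=> t /gM;
  rewrite ler_norml => /andP[].
Qed.

(** Interior points only: g is not assumed periodic, so at the endpoints of the
    period the mean has no reason to converge to g. *)
Lemma fejer_mean_cvg_continuous g x : continuous g -> - pi < x < pi ->
  fejer_mean n.+1 g x @[n --> \oo] --> g x.
Proof.
move=> cg /andP[x1 x2]; have ig := continuous_integ cg.
have [M M0 gM] := continuous_bdd cg.
have xper : per x by rewrite /period /= in_itv/= x2 ltW.
apply/cvgrPdist_le => e e0.
have e20 : 0 < e / 2 by rewrite divr_gt0.
have /cvgrPdist_le /(_ _ e20) := cg x.
move=> /nbhs_ballP[d /= d0 hd].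
(* For t in the period, |x - t| stays below 2 pi - h by the choice of h. *)
pose h := Num.min (d / 2) (Num.min (pi + x) (pi - x)).
have h0 : 0 < h by rewrite !lt_min divr_gt0//=; lra.
have [hd2 hx1 hx2] : [/\ h <= d / 2, h <= pi + x & h <= pi - x].
  by rewrite !ge_min !lexx !orbT.
have hpi : h <= pi by lra.
pose c := 1 - cos h; have c0 : 0 < c by rewrite subr_gt0 cos_lt1_gap.
(* Near x use continuity; far from x, 1 - cos (x - t) is at least c > 0 and
   g is bounded by M. *)
have key t : per t -> `|g t - g x| <= e / 2 + (2 * M / c) * (1 - cos (x - t)).
  move=> Pt; have [tx|tx] := ltP `|x - t| h.
    rewrite distrC (le_trans (hd t _))//; first by rewrite /ball/=; lra.
    by rewrite lerDl mulr_ge0// ?subr_ge0 ?cos_le1// divr_ge0 ?(ltW c0)// mulr_ge0.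
  have /gM gt := Pt; have gx := gM _ xper.
  have : c <= 1 - cos (x - t).
    rewrite lerB// cos_gap// ?(ltW h0)//.
    move: Pt; rewrite /period /= in_itv/= => /andP[t1 t2].
    by rewrite ler_norml; apply/andP; split; lra.
  move=> cc; apply: le_trans (ler_normB _ _) _.
  apply: (@le_trans _ _ (2 * M / c * c)).
    by rewrite divfK ?gt_eqF//; lra.
  apply: (@le_trans _ _ (2 * M / c * (1 - cos (x - t)))).
    by rewrite ler_wpM2l// divr_ge0 ?(ltW c0)// mulr_ge0.
  by rewrite lerDr ltW.
have ic : integ (fun t : R => 1 - cos (x - t)).
  apply: integB; first exact: integ_cst.
  apply: (@integ_bdd _ _ 1) => [|t _]; last exact: norm_cos_le1.
  apply: continuous_meas => t; apply: continuous_comp; last exact: continuous_cos.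
  by apply: cvgB; [exact: cvg_cst|exact: cvg_id].
have bound n : `|g x - fejer_mean n.+1 g x| <= e / 2 + (2 * M / c * 2) * n.+1%:R^-1.
  rewrite distrC -[in X in _ - X](fejer_mean_cst (N := n.+1) (g x) x)// -fejer_meanB//; last exact: integ_cst.
  have igx : integ (fun t => g t - g x) by apply: integB => //; exact: integ_cst.
  have inx : integ (fun t => `|g t - g x| ^+ 1).
    by apply: eq_integ (integ_norm igx) => t _; rewrite expr1.
  have icc := integZ (2 * M / c) ic.
  have H := fejer_mean_jensen x (ltn0Sn n) igx inx.
  rewrite expr1 in H; apply: le_trans H _.
  have key1 t : per t -> `|g t - g x| ^+ 1 <= e / 2 + (2 * M / c) * (1 - cos (x - t)).
    by move=> Pt; rewrite expr1 key.
  apply: le_trans (le_fejer_mean n.+1 x inx (integD (integ_cst (e / 2)) icc) key1) _.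
  rewrite (fejer_meanD n.+1 x (integ_cst (e / 2)) icc) fejer_mean_cst// (fejer_meanZ n.+1 _ x ic).
  rewrite lerD2l -[leRHS]mulrA ler_wpM2l ?divr_ge0 ?mulr_ge0 ?(ltW c0)//.
  rewrite /fejer_mean ler_pdivrMl ?pi2_gt0//.
  apply: le_trans (le_int (v := fun=> n.+1%:R^-1 * 2) _ _ _) _.
  - exact: integMfejer.
  - exact: integ_cst.
  - by move=> t _; rewrite mulrC fejer_decay.
  - by rewrite int_cst [leRHS]mulrC ler_wpM2r ?(ltW pi2_gt0)// mulrC.
(* The summand 1 guards against M = 0. *)
have D0 : 0 < 2 * M / c * 2 + 1.
  by rewrite ltr_wpDl// mulr_ge0// divr_ge0 ?(ltW c0)// mulr_ge0.
have := near_infty_natSinv_lt (PosNum (divr_gt0 e20 D0)).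
apply: filterS => n /=; rewrite ltr_pdivlMr// => H.
apply: le_trans (bound n) _.
have : 0 <= n.+1%:R^-1 :> R by rewrite invr_ge0.
move: H; set A := 2 * M / c; set k := n.+1%:R^-1 => H k0.
have : A * 2 * k + k < e / 2 by apply: le_lt_trans H; rewrite le_eqVlt; apply/orP; left; apply/eqP; ring.
lra.
Qed.

(** The left endpoint of the period is a null set. *)
Lemma ae_interior (Q : R -> Prop) : (forall x, - pi < x < pi -> Q x) ->
  {ae mu, forall x, per x -> Q x}.
Proof.
move=> h; exists [set - pi]; split => //; first exact: lebesgue_measure_set1.
move=> x /=; apply: contra_notP => xpi.
rewrite /period /= in_itv/= => /andP[x1 x2]; apply: h.
by rewrite x2 andbT lt_neqAle x1 andbT eq_sym; apply/eqP.
Qed.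

Lemma measurable_fejer_mean N u : integ u -> measurable_fun per (fejer_mean N u).
Proof. by move=> /(integ_fejer_mean N) /integ_meas. Qed.

(** Pointwise convergence inside the period, dominated because Fejer means do
    not increase the sup norm. *)
Lemma fejer_mean_Lq_continuous q g : continuous g ->
  int_ (fun x => `|fejer_mean n.+1 g x - g x| ^+ q.+1) @[n --> \oo] --> 0.
Proof.
move=> cg; have ig := continuous_integ cg; have [M M0 gM] := continuous_bdd cg.
have -> : 0 = int_ (fun=> 0 : R) by rewrite int_cst mul0r.
apply: (int_dominated (v := fun=> (M + M) ^+ q.+1)).
- move=> n; apply: measurable_funX; apply: measurableT_comp => //.
  by apply: measurable_funB; [exact: measurable_fejer_mean|exact: continuous_meas].
- exact: measurable_cst.
- exact: integ_cst.
- move=> n x Px; rewrite ger0_norm ?exprn_ge0// lerXn2r ?nnegrE ?addr_ge0//.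
  by apply: le_trans (ler_normB _ _) _; rewrite lerD ?gM// fejer_mean_bdd.
- apply: ae_interior => x xpi.
  have -> : 0 = `|0 : R| ^+ q.+1 by rewrite normr0 expr0n.
  apply: (cvg_comp (fun n => `|fejer_mean n.+1 g x - g x|) (fun y : R => y ^+ q.+1)); last exact: exprn_continuous.
  apply: cvg_norm; rewrite -[X in _ --> X](subrr (g x)).
  by apply: cvgB; [exact: fejer_mean_cvg_continuous|exact: cvg_cst].
Qed.

End concentration.

(** * Mean convergence of Fejer means *)

Section density.
Context {R : realType}.
Local Notation mu := (@lebesgue_measure R).
Local Notation per := (@period R).
Implicit Types (N q : nat) (u v g : R -> R) (x t : R).

(** Truncation at height M.  It is 1-Lipschitz, so truncating an approximant of
    a bounded function keeps it continuous and does not make it worse. *)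
Definition clamp (M y : R) : R := Num.max (- M) (Num.min M y).

Lemma clamp_norm M y : 0 <= M -> `|clamp M y| <= M.
Proof.
by move=> M0; rewrite ler_norml /clamp le_max lexx/= ge_max ge_min lexx andbT ge0_cp.
Qed.

Lemma clamp_id M y : `|y| <= M -> clamp M y = y.
Proof. by rewrite ler_norml /clamp => /andP[a b]; rewrite min_r// max_r. Qed.

Lemma clamp_cases M y : 0 <= M ->
  [\/ clamp M y = - M /\ y <= - M, clamp M y = M /\ M <= y | clamp M y = y /\ - M <= y <= M].
Proof.
move=> M0; rewrite /clamp; case: (leP M y) => My.
  by apply: Or32; rewrite max_r//; lra.
case: (leP (- M) y) => [My'|/ltW My']; last by apply: Or31.
by apply: Or33; rewrite ltW.
Qed.

Lemma clamp_lip M a b : 0 <= M -> `|clamp M a - clamp M b| <= `|a - b|.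
Proof.
move=> M0; have h1 := ler_norm (a - b).
have h2 := ler_norm (b - a); rewrite (distrC b a) in h2.
rewrite ler_norml; apply/andP.
by case: (clamp_cases a M0) => -[-> ?]; case: (clamp_cases b M0) => -[-> ?]; split; lra.
Qed.

Lemma clamp_continuous M : 0 <= M -> continuous (clamp M).
Proof.
move=> M0 x; apply/cvgrPdist_le => e e0.
have /cvgrPdist_le /(_ _ e0) := @cvg_id _ (nbhs x).
by apply: filterS => t; move/(le_trans _); apply; exact: clamp_lip.
Qed.

Lemma clamp_dist M y : 0 <= M -> `|y - clamp M y| <= `|y|.
Proof.
move=> M0; have h1 := ler_norm y; have h2 := ler_norm (- y); rewrite normrN in h2.
have h3 := normr_ge0 y; rewrite ler_norml; apply/andP.
by case: (clamp_cases y M0) => -[-> ?]; split; lra.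
Qed.

Lemma integ_of_Lq q u : measurable_fun per u -> integ (fun t => `|u t| ^+ q.+1) ->
  integ u.
Proof.
move=> meas_u iu; apply: integ_le meas_u (integD (integ_cst 1) iu) _ => x _.
have [u1|u1] := leP `|u x| 1.
  by apply: le_trans u1 _; rewrite lerDl exprn_ge0.
apply: le_trans (_ : `|u x| ^+ q.+1 <= _); last by rewrite lerDr.
by rewrite ler_eXnr// ltW.
Qed.

Lemma measurable_powD q u v : measurable_fun per u -> measurable_fun per v ->
  measurable_fun per (fun t => `|u t - v t| ^+ q.+1).
Proof.
move=> meas_u mv; apply: measurable_funX; apply: measurableT_comp => //.
exact: measurable_funB.
Qed.

Lemma measurable_clamp M u : 0 <= M -> measurable_fun per u ->
  measurable_fun per (fun t => clamp M (u t)).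
Proof.
move=> M0 meas_u; apply: (measurableT_comp _ meas_u).
by apply: continuous_measurable_fun; exact: clamp_continuous.
Qed.

Lemma clamp_Lq q u : measurable_fun per u -> integ (fun t => `|u t| ^+ q.+1) ->
  int_ (fun t => `|u t - clamp n%:R (u t)| ^+ q.+1) @[n --> \oo] --> 0.
Proof.
move=> meas_u iu; have -> : 0 = int_ (fun=> 0 : R) by rewrite int_cst mul0r.
apply: (int_dominated (v := fun t => `|u t| ^+ q.+1)) => //.
- by move=> n; apply: measurable_powD => //; exact: measurable_clamp.
- move=> n x _; rewrite ger0_norm ?exprn_ge0// lerXn2r ?nnegrE//.
  exact: clamp_dist.
- apply: aeW => x _; apply/cvgrPdist_le => e e0.
  near=> n; rewrite clamp_id ?subrr ?normr0 ?expr0n ?subr0 ?normr0 ?(ltW e0)//.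
  near: n; exact: nbhs_infty_ger.
Unshelve. all: by end_near. Qed.

Lemma norm_powD q (a b : R) :
  `|a + b| ^+ q.+1 <= 2 ^+ q.+1 * (`|a| ^+ q.+1 + `|b| ^+ q.+1).
Proof.
apply: (@le_trans _ _ ((2 * Num.max `|a| `|b|) ^+ q.+1)).
  rewrite lerXn2r ?nnegrE ?mulr_ge0// ?le_max ?normr_ge0//.
  apply: le_trans (ler_normD _ _) _.
  by rewrite mulr2n mulrDl mul1r lerD// le_max lexx ?orbT.
rewrite exprMn ler_wpM2l ?exprn_ge0//.
by case: (leP `|a| `|b|) => _; rewrite ?lerDl ?lerDr exprn_ge0.
Qed.

Lemma norm_powD3 q (a b c : R) :
  `|a + b + c| ^+ q.+1 <= 3 ^+ q.+1 * (`|a| ^+ q.+1 + `|b| ^+ q.+1 + `|c| ^+ q.+1).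
Proof.
pose m := Num.max `|a| (Num.max `|b| `|c|).
have ? : `|a| <= m by rewrite le_max lexx.
have ? : `|b| <= m by rewrite !le_max lexx orbT.
have ? : `|c| <= m by rewrite !le_max lexx !orbT.
have m0 : 0 <= m by rewrite le_max normr_ge0.
apply: (@le_trans _ _ ((3 * m) ^+ q.+1)).
  rewrite lerXn2r ?nnegrE ?mulr_ge0//.
  by have := ler_normD (a + b) c; have := ler_normD a b; lra.
rewrite exprMn ler_wpM2l ?exprn_ge0//.
have ha : 0 <= `|a| ^+ q.+1 by rewrite exprn_ge0.
have hb : 0 <= `|b| ^+ q.+1 by rewrite exprn_ge0.
have hc : 0 <= `|c| ^+ q.+1 by rewrite exprn_ge0.
by rewrite /m; case: (leP `|b| `|c|) => _; [case: (leP `|a| `|c|) => _|case: (leP `|a| `|b|) => _]; lra.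
Qed.

(** Truncate u to make it bounded, then approximate in L^1.  For functions
    bounded by M, the L^1 distance controls the L^(q+1) distance, because
    |v - g|^(q+1) <= (2M)^q |v - g|. *)
Lemma continuous_dense q u e : measurable_fun per u ->
  integ (fun t => `|u t| ^+ q.+1) -> 0 < e ->
  exists2 g, continuous g & int_ (fun t => `|u t - g t| ^+ q.+1) <= e.
Proof.
move=> meas_u iu e0; pose k : R := 2 ^+ q.+1.
have k0 : 0 < k by rewrite exprn_gt0.
have e1 : 0 < e / 2 / k by rewrite !divr_gt0.
have /cvgrPdist_le/(_ _ e1)[n _ /(_ n (leqnn n))] := clamp_Lq meas_u iu.
rewrite sub0r normrN ger0_norm; last by apply: int_ge0 => x _; rewrite exprn_ge0.
set M : R := n%:R => hM; have M0 : 0 <= M by rewrite ler0n.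
pose v t := clamp M (u t).
have mv : measurable_fun per v by exact: measurable_clamp.
have vM t : `|v t| <= M by exact: clamp_norm.
have iv : integ v by apply: integ_bdd mv _ => t _; exact: vM.
have [g_ [cg ig]] := @approximation_continuous_integrable R per v
  (measurable_itv _) mu_period_lty iv.
have c0 : 0 < (M + M) ^+ q + 1 by rewrite ltr_wpDl// exprn_ge0// addr_ge0.
have e2 : 0 < e / 2 / k / ((M + M) ^+ q + 1) by rewrite divr_gt0.
move=> /fine_cvgP[_] /cvgrPdist_le /(_ _ e2)[m _ /(_ m (leqnn m))].
rewrite sub0r normrN /= -/(Rintegral _ _ _) ger0_norm; last exact: int_ge0.
set g0 := g_ m => hg.
(* g0 approximates v in L^1 but may be unbounded. *)
pose g t := clamp M (g0 t).
have cgg : continuous g.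
  by move=> t; apply: (@continuous_comp _ _ _ g0 (clamp M)); [exact: cg|exact: clamp_continuous].
exists g => //.
have ivg : integ (fun t => `|v t - g0 t|).
  by apply: integ_norm; apply: integB => //; exact: ig.
have gM t : `|g t| <= M by exact: clamp_norm.
have Mle t : `|v t - g t| ^+ q.+1 <= (M + M) ^+ q * `|v t - g0 t|.
  rewrite exprSr ler_pM ?exprn_ge0//.
    rewrite lerXn2r ?nnegrE ?addr_ge0// (le_trans (ler_normB _ _))//.
    by rewrite lerD.
  have -> : v t - g t = clamp M (v t) - clamp M (g0 t) by rewrite (clamp_id (vM t)).
  exact: clamp_lip.
have i1 : integ (fun t => `|u t - v t| ^+ q.+1).
  apply: integ_le iu _ => [|t _]; first exact: measurable_powD.
  by rewrite ger0_norm ?exprn_ge0// lerXn2r ?nnegrE//; exact: clamp_dist.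
have i2 : integ (fun t => `|v t - g t| ^+ q.+1).
  apply: integ_le (integZ ((M + M) ^+ q) ivg) _ => [|t _].
    by apply: measurable_powD => //; exact: continuous_meas.
  by rewrite ger0_norm ?exprn_ge0.
apply: le_trans (le_int (v := fun t => k * (`|u t - v t| ^+ q.+1 + `|v t - g t| ^+ q.+1)) _ _ _) _.
- apply: integ_le (integZ k (integD i1 i2)) _ => [|t _].
    by apply: measurable_powD => //; exact: continuous_meas.
  by rewrite ger0_norm ?exprn_ge0// -(subrKA (v t)) norm_powD.
- by apply: integZ; exact: integD.
- by move=> t _; rewrite -(subrKA (v t)) norm_powD.
rewrite intZ; last exact: integD.
rewrite intD// -ler_pdivlMl// mulrC.
have -> : e / k = e / 2 / k + e / 2 / k by field; rewrite gt_eqF.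
apply: lerD => //.
apply: le_trans (le_int i2 (integZ ((M + M) ^+ q) ivg) _) _ => //.
rewrite intZ//; move: hg; rewrite ler_pdivlMr// => hg; apply: le_trans hg.
by rewrite mulrC ler_wpM2l ?lerDl//; exact: int_ge0.
Qed.

(** Fejer means converge for the dense class of continuous functions, and they
    are contractions uniformly in N. *)
Theorem fejer_mean_Lq q u : measurable_fun per u -> integ (fun t => `|u t| ^+ q.+1) ->
  int_ (fun t => `|fejer_mean n.+1 u t - u t| ^+ q.+1) @[n --> \oo] --> 0.
Proof.
move=> meas_u iuq; have iu := integ_of_Lq meas_u iuq.
apply/cvgrPdist_le => e e0.
pose k : R := 3 ^+ q.+1; have k0 : 0 < k by rewrite exprn_gt0.
have e1 : 0 < e / 3 / k by rewrite !divr_gt0.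
have [g cg ug] := continuous_dense meas_u iuq e1.
have ig := continuous_integ cg.
have /cvgrPdist_le/(_ _ e1) := fejer_mean_Lq_continuous q cg.
apply: filterS => n; rewrite !sub0r !normrN.
rewrite !ger0_norm; try by apply: int_ge0 => x _; rewrite exprn_ge0.
move=> H.
have iug := integB iu ig.
have [M M0 gM] := continuous_bdd cg.
have igq : integ (fun t => `|g t| ^+ q.+1).
  apply: (@integ_bdd _ _ (M ^+ q.+1)) => [|t Pt].
    by apply: measurable_funX; apply: measurableT_comp => //; exact: continuous_meas.
  by rewrite ger0_norm ?exprn_ge0// lerXn2r ?nnegrE// gM.
have iugq : integ (fun t => `|u t - g t| ^+ q.+1).
  apply: integ_le (integZ k (integD (integD iuq igq) igq)) _ => [|t _].
    by apply: measurable_powD => //; exact: continuous_meas.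
  rewrite ger0_norm ?exprn_ge0//; apply: le_trans (_ : `|u t - g t + 0| ^+ q.+1 <= _).
    by rewrite addr0.
  apply: le_trans (norm_powD3 _ _ _ _) _; rewrite normrN normr0 expr0n/= addr0.
  by rewrite ler_wpM2l ?(ltW k0)// lerDl exprn_ge0.
have [i1 le1] := fejer_mean_contraction (ltn0Sn n) iug iugq.
have i2 : integ (fun t => `|fejer_mean n.+1 g t - g t| ^+ q.+1).
  apply: (@integ_bdd _ _ ((M + M) ^+ q.+1)) => [|t Pt].
    by apply: measurable_powD; [exact: measurable_fejer_mean|exact: continuous_meas].
  rewrite ger0_norm ?exprn_ge0// lerXn2r ?nnegrE ?addr_ge0//.
  by apply: le_trans (ler_normB _ _) _; rewrite lerD ?gM// fejer_mean_bdd.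
have i3 := integZ k (integD (integD i1 i2) iugq).
have le3 t : per t -> `|fejer_mean n.+1 u t - u t| ^+ q.+1 <=
   k * (`|fejer_mean n.+1 (fun t => u t - g t) t| ^+ q.+1 + `|fejer_mean n.+1 g t - g t| ^+ q.+1
     + `|u t - g t| ^+ q.+1).
  move=> _; rewrite fejer_meanB// (distrC (u t) (g t)).
  rewrite (_ : fejer_mean n.+1 u t - u t = fejer_mean n.+1 u t - fejer_mean n.+1 g t
    + (fejer_mean n.+1 g t - g t) + (g t - u t)); last by ring.
  exact: norm_powD3.
apply: le_trans (le_int _ i3 le3) _.
  apply: integ_le i3 _ => [|t Pt].
    by apply: measurable_powD => //; exact: measurable_fejer_mean.
  by rewrite ger0_norm ?exprn_ge0// le3.
rewrite intZ; last by apply: integD => //; exact: integD.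
rewrite intD//; last exact: integD.
rewrite intD// -ler_pdivlMl// mulrC.
have -> : e / k = e / 3 / k + e / 3 / k + e / 3 / k by field; rewrite gt_eqF.
by rewrite !lerD// (le_trans le1).
Qed.

End density.

(** * Uniqueness of Fourier coefficients *)

Section uniqueness.
Context {R : realType}.
Local Notation mu := (@lebesgue_measure R).
Local Notation per := (@period R).
Implicit Types (f g h : R -> R[i]) (u v : R -> R).

Lemma integ_pow1 u : integ u -> integ (fun x => `|u x| ^+ 1).
Proof. by move=> /integ_norm; apply: eq_integ => x _; rewrite expr1. Qed.

Lemma fejer_mean_eq0_ae u : integ u -> (forall n x, fejer_mean n.+1 u x = 0) ->
  {ae mu, forall x, per x -> u x = 0}.
Proof.
move=> iu s0; apply: int0_ae => //.
have := fejer_mean_Lq (integ_meas iu) (integ_pow1 iu).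
have -> : (fun n => int_ (fun t => `|fejer_mean n.+1 u t - u t| ^+ 1)) =
    fun=> int_ (fun x => `|u x|).
  apply/funext => n; apply: eq_int => x _.
  by rewrite s0 sub0r normrN expr1.
by move=> /(cvg_unique _ (cvg_cst _)) ->.
Qed.

(** If all coefficients vanish then so do all Fejer means, while these converge
    to the function in L^1. *)
Lemma fourier_coef_eq0_ae h : Cinteg h -> (forall n, fourier_coef h n = 0) ->
  {ae mu, forall x, per x -> h x = 0}.
Proof.
move=> ih h0.
have s0 N x : fejer_meanC N h x = 0.
  by rewrite /fejer_meanC big1// => p _; rewrite h0 mulr0 mul0r.
have hr : {ae mu, forall x, per x -> complex.Re (h x) = 0}.
  apply: (@fejer_mean_eq0_ae (@complex.Re R \o h)) => [|n x]; first by case: ih.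
  by have := s0 n.+1 x; rewrite fejer_meanCE// => -[].
have hi : {ae mu, forall x, per x -> complex.Im (h x) = 0}.
  apply: (@fejer_mean_eq0_ae (@complex.Im R \o h)) => [|n x]; first by case: ih.
  by have := s0 n.+1 x; rewrite fejer_meanCE// => -[].
by apply: ae_imply2 hr hi => x a b Px; apply: complex_ext; [exact: a|exact: b].
Qed.

Lemma fourier_coef_inj_ae f g : Cinteg f -> Cinteg g ->
  (forall n, fourier_coef f n = fourier_coef g n) ->
  {ae mu, forall x, per x -> f x = g x}.
Proof.
move=> fi gi fg; have gi' := CintegZ (-1) gi.
apply: ae_imply (fourier_coef_eq0_ae (CintegD fi gi') _) => [x h /h /eqP|n].
  by rewrite mulN1r subr_eq0 => /eqP.
by rewrite fourier_coefD// fourier_coefZ// fg mulN1r subrr.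
Qed.

(** The function has the same coefficients as the finite sum of its Fourier
    series. *)
Lemma finite_frequencies_trig f (s : seq int) : Cinteg f ->
  (forall n, fourier_coef f n != 0 -> n \in s) -> trig_polynomial f.
Proof.
move=> fi fs; exists (undup s), (fourier_coef f).
apply: (@fourier_coef_inj_ae f (fun x => \sum_(n <- undup s) fourier_coef f n * echar n x)) => //.
  exact: Cinteg_trig.
move=> n; rewrite fourier_coef_trig.
have [ns|ns] := boolP (n \in undup s).
  by rewrite -big_filter filter_pred1_uniq ?undup_uniq// big_seq1.
rewrite big_seq_cond big1 => [|m /andP[ms /eqP mn]]; last by rewrite -mn ms in ns.
by apply/eqP; apply: contraNT ns; rewrite mem_undup; exact: fs.
Qed.

Lemma trig_finite_frequencies f : Cinteg f -> trig_polynomial f ->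
  exists s : seq int, forall n, fourier_coef f n != 0 -> n \in s.
Proof.
move=> fi [s [c fE]]; exists s => n; apply: contraNT => ns.
rewrite (ae_eq_fourier_coef n fi (Cinteg_trig s c id) fE) fourier_coef_trig.
by rewrite big_seq_cond big1// => m /andP[ms /eqP mn]; rewrite -mn ms in ns.
Qed.

End uniqueness.

(** * Invariance of the integral under reflection *)

Section reflection.
Context {R : realType}.
Local Notation mu := (@lebesgue_measure R).
Local Notation per := (@period R).
Local Notation O := (`]- pi, pi[%classic : set R).
Implicit Types (u v : R -> R).

(** The reflection, on the carrier where the Lebesgue measure is defined, so
    that its pushforward is recognised as a measure. *)
Definition oppm (x : measurableTypeR R) : measurableTypeR R := - x.

Lemma measurable_oppm : measurable_fun setT oppm.
Proof. exact: oppr_measurable. Qed.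

HB.instance Definition _ := isMeasurableFun.Build _ _ _ _ oppm measurable_oppm.

Lemma preimage_oppm : oppm @^-1` O = O.
Proof.
by apply/seteqP; split => x; rewrite /oppm/= !in_itv/= => /andP[a b]; apply/andP; split; lra.
Qed.

(** Both measures agree on half-open intervals. *)
Lemma lebesgue_opp (A : set (measurableTypeR R)) :
  measurable A -> mu A = pushforward mu oppm A.
Proof.
apply: lebesgue_measure_unique => _ [[a b] _ <-].
have ab : oppm @^-1` `]a, b] = `[- b, - a[%classic.
  by apply/seteqP; split => x; rewrite /oppm/= !in_itv/= => /andP[? ?]; apply/andP; split; lra.
transitivity (mu `[- b, - a[%classic); last by rewrite -ab.
rewrite !lebesgue_measure_itv/= !lte_fin ltrN2; case: ifPn => // _.
by rewrite -!EFinB opprK addrC.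
Qed.

Lemma measurable_reflect u : measurable_fun per u -> measurable_fun per (fun x => u (- x)).
Proof.
move=> meas_u; apply/measurable_fun_itv_obnd_cbndP.
apply: (@measurable_comp _ _ _ _ _ _ O) => //.
- by move=> _ [x /= + <-]; rewrite !in_itv/= => /andP[a b]; apply/andP; split; lra.
- by apply/measurable_fun_itv_obnd_cbndP.
Qed.

Lemma ge0_integral_reflect u : measurable_fun per u -> (forall x, 0 <= u x) ->
  (\int[mu]_(x in per) (u (- x))%:E = \int[mu]_(x in per) (u x)%:E)%E.
Proof.
move=> meas_u u0.
have mur := measurable_reflect meas_u.
have mE (v : R -> R) : measurable_fun per v -> measurable_fun O (EFin \o v).
  by move=> mv; apply/measurable_EFinP; apply/measurable_fun_itv_obnd_cbndP.
rewrite -(integral_itv_obnd_cbnd (mE _ mur)) -(integral_itv_obnd_cbnd (mE _ meas_u)).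
have u0' : {in O, forall y, (0 <= (EFin \o u) y)%E}.
  by move=> x _; rewrite /= lee_fin.
have := @ge0_integral_pushforward _ _ _ _ R _ measurable_oppm mu O (EFin \o u)
  (measurable_itv _) (mE _ meas_u) u0'.
rewrite preimage_oppm => e; transitivity (\int[pushforward mu oppm]_(y in O) (EFin \o u) y)%E.
  by rewrite e.
apply: eq_measure_integral => A mA _; apply/esym; exact: lebesgue_opp.
Qed.

Lemma integ_reflect u : integ u -> integ (fun x => u (- x)).
Proof.
move=> iu; apply/integrableP; split.
  by apply/measurable_EFinP; exact: measurable_reflect (integ_meas iu).
have /integrableP[_] := iu; apply: le_lt_trans.
rewrite (_ : \int[mu]_(x in per) _ = \int[mu]_(x in per) `|u (- x)|%:E)%E; last exact: eq_integral.
rewrite (@ge0_integral_reflect (fun x => `|u x|))//.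
by apply: measurableT_comp => //; exact: integ_meas.
Qed.

(** Reduction to nonnegative functions through u = (|u| + u) - |u|. *)
Lemma int_reflect u : integ u -> int_ (fun x => u (- x)) = int_ u.
Proof.
move=> iu; have iur := integ_reflect iu.
have ge0 v : integ v -> (forall x, 0 <= v x) -> int_ (fun x => v (- x)) = int_ v.
  by move=> iv v0; rewrite /Rintegral ge0_integral_reflect//; exact: integ_meas.
have e v : int_ v = int_ (fun x => `|v x| + v x - `|v x|).
  by apply: eq_int => x _; rewrite addrAC subrr add0r.
rewrite (e u) (e (fun x => u (- x))).
rewrite intB; [|by apply: integD => //; exact: integ_norm|exact: integ_norm].
rewrite intB; [|by apply: integD => //; exact: integ_norm|exact: integ_norm].
congr (_ - _); last by apply: (ge0 (fun x => `|u x|)) => //; exact: integ_norm.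
apply: (ge0 (fun x => `|u x| + u x)).
  by apply: integD => //; exact: integ_norm.
by move=> x; rewrite -lerBlDr sub0r -normrN ler_norm.
Qed.

End reflection.

(** * Pointwise convexity of the p-th power of the modulus *)

Section duality_pointwise.
Context {R : realType}.
Local Notation Re := (@complex.Re R).
Local Notation Im := (@complex.Im R).
Local Notation normc := (@Normc.normc R).
Variable p : R.
Hypothesis p1 : 1 < p.
Implicit Types (z w : R[i]).

Lemma normc_ge0 z : 0 <= normc z.
Proof. by case: z => a b; exact: sqrtr_ge0. Qed.

Lemma normc_sqrt z : normc z = Num.sqrt (Re z ^+ 2 + Im z ^+ 2).
Proof. by case: z. Qed.

Lemma normc_conj z : normc (conjc z) = normc z.
Proof. by case: z => a b /=; rewrite sqrrN. Qed.

Lemma conjcZ (r : R) z : conjc (r%:C * z) = r%:C * conjc z.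
Proof. by case: z => a b; apply: complex_ext => /=; ring. Qed.

Lemma normc_real (r : R) : normc r%:C = `|r|.
Proof. by rewrite /= expr0n/= addr0 sqrtr_sqr. Qed.

Lemma normRe_le z : `|Re z| <= normc z.
Proof.
by rewrite normc_sqrt -sqrtr_sqr ler_wsqrtr// lerDl sqr_ge0.
Qed.

Lemma normIm_le z : `|Im z| <= normc z.
Proof.
by rewrite normc_sqrt -sqrtr_sqr ler_wsqrtr// lerDr sqr_ge0.
Qed.

(** The duality map of L^p: up to the factor p, the gradient of |z|^p. *)
Definition dual_elt z : R[i] := (normc z `^ (p - 2))%:C * z.
(** The derivative of |z|^p at z in the direction w, divided by p. *)
Definition dpair z w : R := normc z `^ (p - 2) * Re (z * conjc w).

Lemma dpairE z w : dpair z w = Re (dual_elt z * conjc w).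
Proof. by rewrite /dual_elt -mulrA cReM/= mul0r subr0. Qed.

Lemma normc_dual z : normc (dual_elt z) = normc z `^ (p - 1).
Proof.
rewrite Normc.normcM normc_real ger0_norm ?powR_ge0// mulrC.
by rewrite -[RHS](mulr_powRB1 (normc_ge0 z)) ?subr_gt0//; congr (_ * _ `^ _); ring.
Qed.

Lemma dpair_le z w : `|dpair z w| <= normc z `^ (p - 1) * normc w.
Proof.
rewrite dpairE; apply: le_trans (normRe_le _) _.
by rewrite Normc.normcM normc_dual normc_conj.
Qed.

Lemma dpair_self z : dpair z z = normc z `^ p.
Proof.
have p0 := lt_trans ltr01 p1.
have pb0 : 0 < p - 1 by rewrite subr_gt0.
rewrite /dpair -[RHS](mulr_powRB1 (normc_ge0 z) p0).
rewrite -[X in _ = _ * X](mulr_powRB1 (normc_ge0 z) pb0).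
rewrite (_ : p - 1 - 1 = p - 2); last by ring.
have -> : Re (z * conjc z) = normc z * normc z.
  by rewrite -expr2 normc_sqrE; case: z => a b /=; ring.
by rewrite mulrC mulrA.
Qed.

(** Young's inequality for |w| and |z|^(p-1).  With [dpair_self] it says that
    |.|^p lies above its tangent plane at z. *)
Lemma dpair_tangent z w : p * dpair z w <= normc w `^ p + (p - 1) * normc z `^ p.
Proof.
have p0 := lt_trans ltr01 p1.
have pb0 : 0 < p - 1 by rewrite subr_gt0.
have q0 : 0 < p / (p - 1) by rewrite divr_gt0.
have := conjugate_powR (normc_ge0 w) (powR_ge0 (normc z) (p - 1)) p0 q0 _.
rewrite -powRrM (_ : (p - 1) * (p / (p - 1)) = p); last by field; rewrite gt_eqF.
move=> /(_ _) H.
have {}H : normc w * normc z `^ (p - 1) <=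
  normc w `^ p / p + normc z `^ p / (p / (p - 1)).
  by apply: H; field; rewrite !gt_eqF.
have := le_trans (ler_norm _) (dpair_le z w).
rewrite mulrC => /le_trans /(_ H); rewrite -(ler_pM2l p0); move/le_trans; apply.
by rewrite le_eqVlt; apply/orP; left; apply/eqP; field; rewrite !gt_eqF.
Qed.

Lemma dpairD z w1 w2 : dpair z (w1 + w2) = dpair z w1 + dpair z w2.
Proof. by rewrite /dpair rmorphD/= mulrDr cReD mulrDr. Qed.

Lemma dpairZ z (a : R) w : dpair z (a%:C * w) = a * dpair z w.
Proof.
rewrite /dpair mulrCA; congr (_ * _).
by rewrite !cReM; case: z; case: w => * /=; ring.
Qed.

(** The tangent inequality at the perturbed point z + ew, compared with z.  Using
    the perturbed point, not z, bounds the increment from above by a quantity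
    that is linear in e. *)
Lemma dpair_variation z w (e : R) : 
  normc (z + e%:C * w) `^ p - normc z `^ p <= p * e * dpair (z + e%:C * w) w.
Proof.
have := dpair_tangent (z + e%:C * w) z.
set y := z + _; have -> : dpair y z = normc y `^ p - e * dpair y w.
  have -> : z = y + (- e)%:C * w by rewrite rmorphN/= mulNr /y addrK.
  by rewrite dpairD dpairZ dpair_self mulNr.
set A := normc y `^ p; set D := dpair y w; set Z := normc z `^ p => H.
have -> : A - Z = p * e * D + (p * (A - e * D) - (Z + (p - 1) * A)) by ring.
by rewrite gerDl subr_le0.
Qed.

Lemma powR_add1 (a : R) : 0 <= a -> (a + 1) `^ p <= 2 `^ p * (a `^ p + 1).
Proof.
move=> a0; have p0 := ltW (lt_trans ltr01 p1).
apply: (@le_trans _ _ ((2 * Num.max a 1) `^ p)).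
  apply: ge0_ler_powR => //; rewrite ?nnegrE ?addr_ge0 ?mulr_ge0 ?le_max ?a0//.
  by rewrite mulr2n mulrDl mul1r lerD// le_max lexx ?orbT.
rewrite powRM ?le_max ?a0// ler_wpM2l ?powR_ge0//.
case: (leP a 1) => _; first by rewrite powR1 lerDr powR_ge0.
by rewrite lerDl.
Qed.

Lemma cvg0_le (u : nat -> R) e : u n @[n --> \oo] --> 0 -> 0 < e ->
  \forall n \near \oo, `|u n| <= e.
Proof.
move=> /cvgrPdist_le cu e0; have := cu _ e0.
by apply: filterS => n; rewrite sub0r normrN.
Qed.

Lemma powR_cvg0n (u : nat -> R) s : 0 < s -> (forall n, 0 <= u n) ->
  u n @[n --> \oo] --> 0 -> u n `^ s @[n --> \oo] --> 0.
Proof.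
move=> s0 u0 /cvgrPdist_le cu; apply/cvgrPdist_le => e e0.
have := cu _ (powR_gt0 s^-1 e0); apply: filterS => n.
rewrite !sub0r !normrN !ger0_norm ?powR_ge0// => h.
rewrite -[leRHS](powRr1 (ltW e0)) -(mulVf (lt0r_neq0 s0)) powRrM.
by apply: ge0_ler_powR; rewrite ?nnegrE ?powR_ge0// ltW.
Qed.

(** At z = 0 the factor |z|^(p-2) blows up for p < 2; there the
    bound of [dpair_le] is used, and elsewhere the continuity of both factors. *)
Lemma dpair_cvg z w : dpair (z + (n.+1%:R^-1)%:C * w) w @[n --> \oo] --> dpair z w.
Proof.
have cn : n.+1%:R^-1 @[n --> \oo] --> (0 : R).
  apply/cvgrPdist_le => e e0.
  have := near_infty_natSinv_lt (PosNum e0); apply: filterS => n /= h.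
  by rewrite sub0r normrN ger0_norm ?invr_ge0// ltW.
have [->|z0] := eqVneq z 0.
  have -> : dpair 0 w = 0 by rewrite /dpair mul0r /= mulr0.
  apply/cvgrPdist_le => e e0.
  have c1 : n.+1%:R^-1 * normc w @[n --> \oo] --> 0.
    by rewrite -(mul0r (normc w)); apply: cvgMl.
  have c2 : (n.+1%:R^-1 * normc w) `^ (p - 1) * normc w @[n --> \oo] --> 0.
    rewrite -[X in _ --> X](mul0r (normc w)); apply: cvgMl.
    by apply: powR_cvg0n c1 => [|n]; rewrite ?subr_gt0// mulr_ge0 ?invr_ge0 ?normc_ge0.
  have := cvg0_le c2 e0; apply: filterS => n.
  rewrite sub0r normrN; apply: le_trans; rewrite add0r; apply: le_trans (dpair_le _ _) _.
  rewrite Normc.normcM normc_real ger0_norm ?invr_ge0//; exact: ler_norm.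
have z0' : 0 < normc z.
  rewrite lt_neqAle normc_ge0 andbT eq_sym; apply: contraNneq z0 => /Normc.eq0_normc ->.
  by [].
apply: cvgM; last first.
  have -> : (fun n => Re ((z + (n.+1%:R^-1)%:C * w) * conjc w)) =
    (fun n => Re (z * conjc w) + n.+1%:R^-1 * Re (w * conjc w)).
    apply/funext => n; rewrite mulrDl cReD; congr (_ + _).
    by rewrite -mulrA cReM /= mul0r subr0.
  rewrite -[X in _ --> X]addr0; apply: cvgD; first exact: cvg_cst.
  by rewrite -(mul0r (Re (w * conjc w))); apply: cvgMl.
have cz : normc (z + (n.+1%:R^-1)%:C * w) @[n --> \oo] --> normc z.
  have c1 : n.+1%:R^-1 * normc w @[n --> \oo] --> 0.
    by rewrite -(mul0r (normc w)); apply: cvgMl.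
  apply/cvgrPdist_le => e e0; have := cvg0_le c1 e0.
  apply: filterS => n; apply: le_trans; apply: le_trans (ler_norm _).
  have -> : n.+1%:R^-1 * normc w = normc ((n.+1%:R^-1)%:C * w).
    by rewrite Normc.normcM normc_real ger0_norm// invr_ge0.
  set y := _%:C * w.
  have h1 := le_normcD z y.
  have h2 := le_normcD (z + y) (- y); rewrite addrK normcN in h2.
  by rewrite ler_norml; apply/andP; split; lra.
have cp : {for normc z, continuous (fun a : R => a `^ (p - 2))}.
  apply/differentiable_continuous/derivable1_diffP.
  by apply: derivable_powR; rewrite in_itv/= z0'.
exact: (cvg_comp _ (fun a => a `^ (p - 2)) cz cp).
Qed.

End duality_pointwise.

(** * The first variation of the norm *)

Section Lp_spaces.
Context {R : realType}.
Local Notation mu := (@lebesgue_measure R).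
Local Notation per := (@period R).
Local Notation Re := (@complex.Re R).
Local Notation Im := (@complex.Im R).
Local Notation normc := (@Normc.normc R).
Implicit Types (f g F G : R -> R[i]) (p : R).

Definition Cmeas f := measurable_fun per (fun x => Re (f x)) /\
  measurable_fun per (fun x => Im (f x)).

Lemma measurable_normc f : Cmeas f -> measurable_fun per (fun x => normc (f x)).
Proof.
move=> [m1 m2].
have -> : (fun x => normc (f x)) = (fun x => Num.sqrt (Re (f x) ^+ 2 + Im (f x) ^+ 2)).
  by apply/funext => x; rewrite normc_sqrt.
apply: (measurableT_comp (f := @Num.sqrt R)).
  by apply: continuous_measurable_fun; exact: sqrt_continuous.
by apply: measurable_funD; exact: measurable_funX.
Qed.

Lemma measurable_normc_powR f p : Cmeas f ->
  measurable_fun per (fun x => normc (f x) `^ p).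
Proof.
by move=> mf; apply: (measurableT_comp (measurable_powR p)); exact: measurable_normc.
Qed.

Lemma CmeasD f g : Cmeas f -> Cmeas g -> Cmeas (fun x => f x + g x).
Proof.
move=> [f1 f2] [g1 g2]; split.
  by under eq_fun do rewrite cReD; exact: measurable_funD.
by under eq_fun do rewrite cImD; exact: measurable_funD.
Qed.

Lemma CmeasM f g : Cmeas f -> Cmeas g -> Cmeas (fun x => f x * g x).
Proof.
move=> [f1 f2] [g1 g2]; split.
  by under eq_fun do rewrite cReM; apply: measurable_funB; exact: measurable_funM.
by under eq_fun do rewrite cImM; apply: measurable_funD; exact: measurable_funM.
Qed.

Lemma CmeasJ f : Cmeas f -> Cmeas (fun x => conjc (f x)).
Proof.
move=> [f1 f2]; split.
  by have -> : (fun x => Re (conjc (f x))) = (fun x => Re (f x)) by apply/funext => x; case: (f x).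
have -> : (fun x => Im (conjc (f x))) = (fun x => - Im (f x)) by apply/funext => x; case: (f x).
exact: measurableT_comp.
Qed.

Lemma Cmeas_real (u : R -> R) : measurable_fun per u -> Cmeas (fun x => (u x)%:C).
Proof. by split => //=; exact: measurable_cst. Qed.

Lemma CintegP f : Cmeas f -> integ (fun x => normc (f x)) -> Cinteg f.
Proof.
move=> [f1 f2] fi; split; [apply: integ_le f1 fi _|apply: integ_le f2 fi _] => x _ /=.
  exact: normRe_le.
exact: normIm_le.
Qed.

(** Finiteness of the norm, restated as integrability so that real-valued
    integrals can be used. *)
Lemma in_LpP p f : 0 < p ->
  in_Lp p f <-> Cmeas f /\ integ (fun x => normc (f x) `^ p).
Proof.
move=> p0; have c0 : ((2 * pi)^-1 != 0 :> R) by rewrite invr_eq0 pi2_neq0.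
split=> [[m1 m2 fp]|[[m1 m2] fi]].
  have mf : Cmeas f by [].
  split => //; apply/integrableP; split.
    by apply/measurable_EFinP; exact: measurable_normc_powR.
  move: fp; rewrite /circle_Lnorm => /lty_poweRy; rewrite invr_eq0 gt_eqF// => /(_ isT).
  rewrite (_ : \int[mu]_(x in per) `|_| = \int[mu]_(x in per) (normc (f x) `^ p)%:E)%E; last first.
    by apply: eq_integral => x _ /=; rewrite ger0_norm ?powR_ge0.
  have : (0 <= \int[mu]_(x in per) (normc (f x) `^ p)%:E)%E.
    by apply: integral_ge0 => x _; rewrite lee_fin powR_ge0.
  case: (integral _ _ _) => [r|//|//] _; first by move=> _; rewrite ltry.
  by rewrite gt0_muley ?lte_fin ?invr_gt0 ?pi2_gt0.
split => //; rewrite /circle_Lnorm poweR_lty// (integral_int fi).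
by rewrite -EFinM ltry.
Qed.

Lemma Lnorm_le_int p f g : 0 < p -> integ (fun x => normc (f x) `^ p) ->
  integ (fun x => normc (g x) `^ p) -> (circle_Lnorm p f <= circle_Lnorm p g)%E ->
  int_ (fun x => normc (f x) `^ p) <= int_ (fun x => normc (g x) `^ p).
Proof.
move=> p0 fi gi; rewrite /circle_Lnorm !integral_int// -!EFinM !poweR_EFin lee_fin.
have i0 h : 0 <= (2 * pi)^-1 * int_ (fun x => normc (h x) `^ p).
  by rewrite mulr_ge0 ?invr_ge0 ?(ltW pi2_gt0)//; apply: int_ge0 => x _; rewrite powR_ge0.
rewrite !leNgt; apply: contra => h; apply: gt0_ltr_powR; rewrite ?nnegrE ?i0 ?invr_gt0//.
by rewrite ltr_pM2l ?invr_gt0 ?pi2_gt0.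
Qed.

Lemma Lp_L1 p f : 1 < p -> Cmeas f -> integ (fun x => normc (f x) `^ p) -> Cinteg f.
Proof.
move=> p1 mf fi; apply: CintegP => //.
apply: integ_le (measurable_normc mf) (integD (integ_cst 1) fi) _ => x _.
rewrite ger0_norm ?normc_ge0//.
have [h|h] := leP (normc (f x)) 1; first by rewrite (le_trans h)// lerDl powR_ge0.
by rewrite (le_trans (le1r_powR (ltW h) (ltW p1)))// lerDr.
Qed.

Lemma Lp_add_bdd p f g : 1 < p -> Cmeas f -> Cmeas g ->
  integ (fun x => normc (f x) `^ p) -> (forall x, normc (g x) <= 1) ->
  integ (fun x => normc (f x + g x) `^ p).
Proof.
move=> p1 mf mg fi g1.
apply: integ_le (measurable_normc_powR p (CmeasD mf mg))
  (integZ (2 `^ p) (integD fi (integ_cst 1))) _ => x _.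
rewrite ger0_norm ?powR_ge0//; apply: le_trans (powR_add1 p1 (normc_ge0 _)).
apply: ge0_ler_powR; rewrite ?nnegrE ?normc_ge0 ?addr_ge0 ?normc_ge0//; first by lra.
by apply: le_trans (le_normcD _ _) _; rewrite lerD2l.
Qed.

(** The increment of the p-th power of the norm is at most e p times the
    derivative at F + eG.  Divide by e and let e tend to 0: the derivatives
    converge by dominated convergence, since p > 1 and G is bounded. *)
Lemma first_variation_ge0 p F G : 1 < p -> Cmeas F -> Cmeas G ->
  integ (fun x => normc (F x) `^ p) -> (forall x, normc (G x) <= 1) ->
  (forall e : R, 0 < e -> e <= 1 ->
    int_ (fun x => normc (F x) `^ p) <= int_ (fun x => normc (F x + e%:C * G x) `^ p)) ->
  0 <= int_ (fun x => dpair p (F x) (G x)).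
Proof.
move=> p1 mF mG iF G1 Fmin; have p0 : 0 < p by lra.
pose e n : R := n.+1%:R^-1.
have e0 n : 0 < e n by rewrite invr_gt0.
have e1 n : e n <= 1 by rewrite invf_le1// ler1n.
pose Fn n x := F x + (e n)%:C * G x.
have meG n : Cmeas (fun x => (e n)%:C * G x).
  by apply: CmeasM => //; apply: Cmeas_real; exact: measurable_cst.
have mFn n : Cmeas (Fn n) by exact: CmeasD.
have eG1 n x : normc ((e n)%:C * G x) <= 1.
  rewrite Normc.normcM normc_real gtr0_norm//.
  by rewrite -[leRHS]mulr1 ler_pM ?normc_ge0// ltW.
have mdp H : Cmeas H -> measurable_fun per (fun x => dpair p (H x) (G x)).
  move=> mH; apply: measurable_funM; first exact: measurable_normc_powR.
  by have [] := CmeasM mH (CmeasJ mG).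
pose B x := 2 `^ p * (normc (F x) `^ p + 1).
have iB : integ B by apply: integZ; apply: integD => //; exact: integ_cst.
have bound n x : `|dpair p (Fn n x) (G x)| <= B x.
  apply: le_trans (dpair_le p1 _ _) _.
  apply: (@le_trans _ _ (normc (Fn n x) `^ (p - 1))).
    by rewrite ler_piMr ?powR_ge0.
  apply: (@le_trans _ _ ((normc (F x) + 1) `^ (p - 1))).
    have pb : 0 <= p - 1 by rewrite subr_ge0 ltW.
    apply: (ge0_ler_powR pb); rewrite ?nnegrE ?normc_ge0 ?addr_ge0 ?normc_ge0//.
    by rewrite /Fn; apply: le_trans (le_normcD _ _) _; rewrite lerD2l.
  apply: le_trans (powR_add1 p1 (normc_ge0 _)).
  by apply: ler_powR; [rewrite lerDr normc_ge0|lra].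
have cv : int_ (fun x => dpair p (Fn n x) (G x)) @[n --> \oo] -->
    int_ (fun x => dpair p (F x) (G x)).
  apply: (int_dominated (v := B)) => //.
  - by move=> n; exact: mdp.
  - exact: mdp.
  - by apply: aeW => x _; exact: dpair_cvg.
rewrite -(cvg_lim _ cv)//; apply: limr_ge; first by apply/cvg_ex; eexists; exact: cv.
apply: nearW => n /=.
have iFn := Lp_add_bdd p1 mF (meG n) iF (eG1 n).
have idp : integ (fun x => dpair p (Fn n x) (G x)).
  by apply: integ_le iB _ => [|x _]; [exact: mdp|exact: bound].
rewrite -(pmulr_rge0 _ (mulr_gt0 p0 (e0 n))) -intZ//.
apply: (@le_trans _ _ (int_ (fun x => normc (Fn n x) `^ p) - int_ (fun x => normc (F x) `^ p))).
  by rewrite subr_ge0; exact: Fmin.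
rewrite -intB//; apply: le_int; [exact: integB|exact: integZ|].
by move=> x _; exact: dpair_variation.
Qed.

End Lp_spaces.

(** * First-order conditions for a minimal majorant *)

Section dual_function.
Context {R : realType}.
Local Notation mu := (@lebesgue_measure R).
Local Notation per := (@period R).
Local Notation Re := (@complex.Re R).
Local Notation Im := (@complex.Im R).
Local Notation normc := (@Normc.normc R).
Local Notation Cint g := (Cintegral per g).
Implicit Types (f g F G : R -> R[i]) (p : R).

Lemma Cmeas_echar n : Cmeas (@echar R n).
Proof. by split; [exact: measurable_cosn|exact: measurable_sinn]. Qed.

Lemma Cmeas_dual p F : Cmeas F -> Cmeas (fun x => dual_elt p (F x)).
Proof.
by move=> mF; apply: CmeasM => //; apply: Cmeas_real; exact: measurable_normc_powR.
Qed.

Lemma Cinteg_dual p F : 1 < p -> Cmeas F -> integ (fun x => normc (F x) `^ p) ->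
  Cinteg (fun x => dual_elt p (F x)).
Proof.
move=> p1 mF iF; have mK := Cmeas_dual p mF; apply: CintegP => //.
apply: integ_le (measurable_normc mK) (integD (integ_cst 1) iF) _ => x _.
rewrite ger0_norm ?normc_ge0// normc_dual//.
have pb : 0 <= p - 1 by rewrite subr_ge0 ltW.
have [h|h] := leP (normc (F x)) 1.
  have : normc (F x) `^ (p - 1) <= 1 `^ (p - 1).
    by apply: (ge0_ler_powR pb) h; rewrite ?nnegrE ?normc_ge0.
  by rewrite powR1 => /le_trans; apply; rewrite lerDl powR_ge0.
have : normc (F x) `^ (p - 1) <= normc (F x) `^ p.
  by apply: ler_powR; [exact: ltW|rewrite gerDl lerN10].
by move=> /le_trans; apply; rewrite lerDr.
Qed.

(** In the order of complex numbers a nonnegative number is in particular real. *)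
Lemma majorantP f F : majorant f F <->
  forall n, Im (fourier_coef F n) = 0 /\ normc (fourier_coef f n) <= Re (fourier_coef F n).
Proof.
split=> h n; have := h n; rewrite lecE /=.
  by move=> /andP[/eqP ? ?].
by move=> [-> ->]; rewrite eqxx.
Qed.

Lemma minimal_int p f F G : 0 < p -> minimal_majorant p f F -> Cmeas G ->
  integ (fun x => normc (G x) `^ p) -> majorant f G ->
  int_ (fun x => normc (F x) `^ p) <= int_ (fun x => normc (G x) `^ p).
Proof.
move=> p0 [/(in_LpP _ p0)[mF iF] _ Fmin] mG iG fG.
by apply: Lnorm_le_int => //; apply: Fmin => //; apply/(in_LpP _ p0).
Qed.

Lemma int_dpair_echar p F (c : R) n : Cinteg (fun x => dual_elt p (F x)) ->
  int_ (fun x => dpair p (F x) (c%:C * echar n x)) =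
  c * (2 * pi * Re (fourier_coef (fun x => dual_elt p (F x)) n)).
Proof.
move=> iK; have [iKr _] := CintegMechar (- n) iK.
rewrite fourier_coefE cReM/= mul0r subr0 mulVKf ?pi2_neq0// -intZ//.
by apply: eq_int => x _ /=; rewrite dpairZ dpairE echarN.
Qed.

(** The direction c exp(inx) changes only the n-th coefficient, by c e with
    0 < e <= 1.  The second hypothesis says that the majorant property survives
    this change: the margin consumed is at most max(0, -c). *)
Lemma dual_variation p f F (c : R) n : 1 < p -> minimal_majorant p f F -> `|c| <= 1 ->
  normc (fourier_coef f n) <= Re (fourier_coef F n) - Num.max 0 (- c) ->
  0 <= c * Re (fourier_coef (fun x => dual_elt p (F x)) n).
Proof.
move=> p1 Fmin c1 hc; have p0 := lt_trans ltr01 p1.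
have [/(in_LpP _ p0)[mF iF] /majorantP fF _] := Fmin.
have iF1 := Lp_L1 p1 mF iF.
have iK := Cinteg_dual p1 mF iF.
pose G x := c%:C * echar n x.
have mG : Cmeas G.
  apply: CmeasM; last exact: Cmeas_echar.
  by apply: Cmeas_real; exact: measurable_cst.
have G1 x : normc (G x) <= 1.
  by rewrite Normc.normcM normc_real normc_echar mulr1.
have := first_variation_ge0 p1 mF mG iF G1.
rewrite int_dpair_echar// mulrCA pmulr_rge0 ?pi2_gt0//; apply => e e0 e1.
have meG : Cmeas (fun x => e%:C * G x).
  by apply: CmeasM => //; apply: Cmeas_real; exact: measurable_cst.
apply: (minimal_int p0 Fmin); first exact: CmeasD.
  apply: Lp_add_bdd => // x; rewrite Normc.normcM normc_real gtr0_norm//.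
  by rewrite -[leRHS]mulr1 ler_pM ?normc_ge0// ltW.
apply/majorantP => m.
have iG : Cinteg G by apply: CintegZ; exact: Cinteg_echar.
rewrite fourier_coefD ?fourier_coefZ ?fourier_coef_echar//; try exact: Cinteg_echar; last exact: CintegZ.
have [f1 f2] := fF m; rewrite cReD cImD f1.
case: eqP => [<-|_]; last by rewrite !mulr0 /= !addr0.
rewrite mulr1 -rmorphM /= addr0; split => //.
apply: le_trans hc _; rewrite lerD2l.
have [c0|c0] := leP 0 c; first by rewrite max_l ?oppr_le0// oppr0 mulr_ge0// ltW.
rewrite max_r ?opprK; last by rewrite oppr_ge0 ltW.
by rewrite -subr_ge0 -[X in _ - X]mul1r -mulrBl mulr_le0 ?subr_le0// ltW.
Qed.

Lemma dual_coef_ge0 p f F n : 1 < p -> minimal_majorant p f F ->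
  0 <= Re (fourier_coef (fun x => dual_elt p (F x)) n).
Proof.
move=> p1 Fmin; rewrite -[X in 0 <= X]mul1r; apply: (dual_variation p1 Fmin).
  by rewrite normr1.
rewrite max_l ?oppr_le0// subr0.
by have [_ /majorantP/(_ n)[]] := Fmin.
Qed.

(** Where the majorant is strict, the direction -exp(inx), scaled to fit into the
    margin, is admissible as well. *)
Lemma dual_coef_eq0 p f F n : 1 < p -> minimal_majorant p f F ->
  normc (fourier_coef f n) < Re (fourier_coef F n) ->
  Re (fourier_coef (fun x => dual_elt p (F x)) n) = 0.
Proof.
move=> p1 Fmin; rewrite -subr_gt0; set t := _ - _ => t0.
apply/le_anti/andP; split; last exact: dual_coef_ge0 Fmin.
(* The scale min(1, t) keeps both |c| <= 1 and the margin t. *)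
have c0 : 0 < Num.min 1 t by rewrite lt_min ltr01.
have : 0 <= - Num.min 1 t * Re (fourier_coef (fun x => dual_elt p (F x)) n).
  apply: (dual_variation p1 Fmin).
    by rewrite normrN gtr0_norm// ge_min lexx.
  rewrite opprK max_r ?(ltW c0)// lerBrDr -lerBrDl -/t.
  by rewrite ge_min lexx orbT.
by rewrite mulNr oppr_ge0 pmulr_rle0.
Qed.

Lemma Cint_conj g : Cinteg g -> Cint (fun x => conjc (g x)) = conjc (Cint g).
Proof.
move=> [_ gi]; congr (_ +i* _); last rewrite -intN//.
  by apply: eq_int => x _; case: (g x).
by apply: eq_int => x _ /=; case: (g x).
Qed.

Lemma Cinteg_reflect g : Cinteg g -> Cinteg (fun x => conjc (g (- x))).
Proof.
move=> [/integ_reflect g1 /integ_reflect g2]; split.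
  by apply: eq_integ g1 => x _ /=; case: (g (- x)).
by apply: eq_integ (integN g2) => x _ /=; case: (g (- x)).
Qed.

Lemma fourier_coef_reflect g n : Cinteg g ->
  fourier_coef (fun x => conjc (g (- x))) n = conjc (fourier_coef g n).
Proof.
move=> gi; have gi' := CintegMechar (- n) gi.
rewrite !fourier_coefE conjcZ; congr (_ * _).
rewrite (eq_Cint (g := fun x => conjc ((fun y => g y * echar (- n) y) (- x)))).
  rewrite -[RHS]Cint_conj//; have [h1 h2] := gi'.
  congr (_ +i* _).
    rewrite -(int_reflect (u := fun x => Re (conjc (g x * echar (- n) x))))//.
    by apply: eq_integ h1 => x _ /=; case: (_ * _).
  rewrite -(int_reflect (u := fun x => Im (conjc (g x * echar (- n) x))))//.
  by apply: eq_integ (integN h2) => x _ /=; case: (_ * _).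
move=> x _; rewrite rmorphM/=; congr (_ * _).
by rewrite -[RHS]echarN opprK /echar mulrN -mulNr rmorphN.
Qed.

Lemma dual_conj p (z : R[i]) : dual_elt p (conjc z) = conjc (dual_elt p z).
Proof. by rewrite /dual_elt normc_conj conjcZ. Qed.

(** A function with real coefficients satisfies conj F(-x) = F(x) almost
    everywhere, by uniqueness; the duality map commutes with conjugation, so it
    preserves this symmetry, which in turn makes coefficients real. *)
Lemma dual_coef_real p F : 1 < p -> Cmeas F -> integ (fun x => normc (F x) `^ p) ->
  (forall n, Im (fourier_coef F n) = 0) ->
  forall n, Im (fourier_coef (fun x => dual_elt p (F x)) n) = 0.
Proof.
move=> p1 mF iF F0 n.
have iF1 := Lp_L1 p1 mF iF.
have iK := Cinteg_dual p1 mF iF.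
have FE : {ae mu, forall x, per x -> conjc (F (- x)) = F x}.
  apply: (fourier_coef_inj_ae (Cinteg_reflect iF1) iF1) => m; rewrite fourier_coef_reflect//.
  by have := F0 m; case: (fourier_coef F m) => a b /= ->; rewrite oppr0.
have := ae_eq_fourier_coef n (Cinteg_reflect iK) iK; rewrite (fourier_coef_reflect n iK) => /(_ _) KE.
have {KE} : conjc (fourier_coef (fun x => dual_elt p (F x)) n) =
    fourier_coef (fun x => dual_elt p (F x)) n.
  by apply: KE; apply: ae_imply FE => x h /h <-; rewrite -dual_conj.
case: (fourier_coef _ n) => a b /= [] /eqP.
by rewrite eq_sym -addr_eq0 -mulr2n mulrn_eq0/= => /eqP.
Qed.

End dual_function.

(** * Continuity of Fourier coefficients under the maps z^a conj(z)^b *)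

Section power_maps.
Context {R : realType}.
Local Notation mu := (@lebesgue_measure R).
Local Notation per := (@period R).
Local Notation Re := (@complex.Re R).
Local Notation Im := (@complex.Im R).
Local Notation normc := (@Normc.normc R).
Local Notation Cint g := (Cintegral per g).
Implicit Types (f g h : R -> R[i]) (z w : R[i]) (phi : R[i] -> R[i]).

(** For a = j and b = j - 1 this is the inverse of the duality map of L^p with
    p = 2j/(2j-1). *)
Definition zpow (a b : nat) z : R[i] := z ^+ a * conjc z ^+ b.

(** A growth and Lipschitz condition of degree n that is stable under
    multiplication by z and by conj z.  Requiring M >= 1 allows the weaker
    power M^n in the Lipschitz bound in place of M^(n-1). *)
Definition poly_lip phi (n : nat) := forall z w (M : R), 1 <= M ->
  normc z <= M -> normc w <= M ->
  normc (phi w) <= M ^+ n /\ normc (phi z - phi w) <= n%:R * normc (z - w) * M ^+ n.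

Lemma poly_lip_mul phi n (s : R[i] -> R[i]) : poly_lip phi n ->
  (forall z, normc (s z) = normc z) -> (forall z w, s z - s w = s (z - w)) ->
  poly_lip (fun z => s z * phi z) n.+1.
Proof.
move=> phil sn sB z w M M1 zM wM.
have M0 : 0 <= M by rewrite (le_trans ler01).
have [h1 h2] := phil z w M M1 zM wM; split.
  by rewrite Normc.normcM sn exprS ler_pM ?normc_ge0.
have -> : s z * phi z - s w * phi w = s z * (phi z - phi w) + (s z - s w) * phi w by ring.
apply: le_trans (le_normcD _ _) _; rewrite !Normc.normcM sB !sn.
set d := normc (z - w); have d0 : 0 <= d by exact: normc_ge0.
apply: (@le_trans _ _ (M * (n%:R * d * M ^+ n) + d * M ^+ n)).
  by apply: lerD; apply: ler_pM; rewrite ?normc_ge0.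
rewrite -natr1 exprS.
have -> : (n%:R + 1) * d * (M * M ^+ n) =
   M * (n%:R * d * M ^+ n) + d * M ^+ n * M by ring.
by rewrite lerD2l ler_peMr ?mulr_ge0 ?exprn_ge0.
Qed.

Lemma poly_lip_zpow a b : poly_lip (zpow a b) (a + b).
Proof.
elim: a => [|a IH]; last first.
  rewrite addSn; have := poly_lip_mul IH (fun=> erefl) (fun _ _ => erefl).
  by move=> h z w M; have := h z w M; rewrite /zpow !exprS !mulrA.
rewrite add0n; elim: b => [|b IH].
  move=> z w M M1 _ _; rewrite /zpow !expr0 mul1r subrr Normc.normc0 Normc.normc1.
  by rewrite !mul0r.
have := poly_lip_mul IH (@normc_conj R) (fun z w => esym (rmorphB _ z w)).
by move=> h z w M; have := h z w M; rewrite /zpow !expr0 !mul1r !exprS.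
Qed.

(** Either z is close to w relative to 1 + |w|, and the Lipschitz bound is a small
    multiple of (1 + |w|)^(q+1); or 1 + |w| is at most a constant times |z - w|,
    and the bound is a multiple of |z - w|^(q+1). *)
Lemma poly_lip_split phi n q (d : R) : poly_lip phi n -> (n <= q)%N -> 0 < d ->
  exists2 A : R, 0 <= A & forall z w,
    normc (phi z - phi w) <= d * (1 + normc w) ^+ q.+1 + A * normc (z - w) ^+ q.+1.
Proof.
move=> phil nq d0; pose c : R := n%:R * 2 ^+ q + 1.
have c0 : 0 < c by rewrite ltr_wpDl// mulr_ge0// exprn_ge0.
(* eta is the threshold on |z - w| / (1 + |w|) separating the two regimes. *)
pose eta := Num.min 1 (d / c).
have eta0 : 0 < eta by rewrite lt_min ltr01 divr_gt0.
have eta1 : eta <= 1 by rewrite ge_min lexx.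
have etac : eta * c <= d by rewrite -ler_pdivlMr// ge_min lexx orbT.
exists (n%:R * (2 / eta) ^+ q).
  by rewrite mulr_ge0// exprn_ge0// divr_ge0// ltW.
move=> z w; set t := normc (z - w); set x := 1 + normc w.
have t0 : 0 <= t by exact: normc_ge0.
have x1 : 1 <= x by rewrite lerDl normc_ge0.
have zxt : normc z <= x + t.
  have := le_normcD w (z - w); rewrite subrKC => /le_trans; apply.
  by rewrite lerD2r lerDr.
have M1 : 1 <= x + t by rewrite (le_trans x1)// lerDl.
have wxt : normc w <= x + t.
  by rewrite (le_trans (_ : _ <= x))// ?lerDl// lerDr.
have [_ H] := phil z w _ M1 zxt wxt; apply: le_trans H _; rewrite -/t.
have Mq : (x + t) ^+ n <= (x + t) ^+ q by rewrite ler_weXn2l.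
have H : n%:R * t * (x + t) ^+ n <= n%:R * t * (x + t) ^+ q.
  by rewrite ler_wpM2l// mulr_ge0.
apply: le_trans H _.
have x0 : 0 <= x by rewrite (le_trans ler01).
have xt0 : 0 <= x + t by rewrite addr_ge0.
have [tx|tx] := leP t (eta * x).
  apply: (@le_trans _ _ (d * x ^+ q.+1)); last first.
    by rewrite lerDl mulr_ge0 ?exprn_ge0// mulr_ge0// exprn_ge0// divr_ge0// ltW.
  have tx1 : t <= x by rewrite (le_trans tx)// ler_piMl.
  have : (x + t) ^+ q <= 2 ^+ q * x ^+ q.
    by rewrite -exprMn lerXn2r ?nnegrE ?mulr_ge0//; lra.
  move=> H; apply: (@le_trans _ _ (n%:R * (eta * x) * (2 ^+ q * x ^+ q))).
    by apply: ler_pM; rewrite ?mulr_ge0 ?exprn_ge0// ler_wpM2l.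
  have -> : n%:R * (eta * x) * (2 ^+ q * x ^+ q) = eta * (n%:R * 2 ^+ q) * x ^+ q.+1.
    by rewrite exprS; ring.
  rewrite ler_wpM2r ?exprn_ge0//; apply: le_trans etac.
  by rewrite ler_wpM2l ?(ltW eta0)// lerDl.
apply: (@le_trans _ _ (n%:R * (2 / eta) ^+ q * t ^+ q.+1)); last first.
  by rewrite lerDr mulr_ge0 ?exprn_ge0// ltW.
have xte : x + t <= 2 / eta * t.
  have : x <= t / eta by rewrite ler_pdivlMr// mulrC ltW.
  have : t <= t / eta by rewrite ler_pdivlMr// ler_piMr.
  by rewrite mulrAC [2 * t]mulrC -mulrA mulrCA; lra.
have : (x + t) ^+ q <= (2 / eta) ^+ q * t ^+ q.
  have et0 : 0 <= 2 / eta * t by rewrite (le_trans xt0).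
  by rewrite -exprMn lerXn2r ?nnegrE.
move=> H; apply: (@le_trans _ _ (n%:R * t * ((2 / eta) ^+ q * t ^+ q))).
  by rewrite ler_wpM2l// mulr_ge0.
by rewrite le_eqVlt; apply/orP; left; apply/eqP; rewrite exprS; ring.
Qed.

Lemma CmeasB f g : Cmeas f -> Cmeas g -> Cmeas (fun x => f x - g x).
Proof.
move=> mf mg; have mN : Cmeas (fun=> (-1)%:C : R[i]).
  by apply: Cmeas_real; exact: measurable_cst.
have -> : (fun x => f x - g x) = (fun x => f x + (-1)%:C * g x).
  by apply/funext => x; rewrite rmorphN1 mulN1r.
by apply: CmeasD => //; exact: CmeasM.
Qed.

Lemma Cmeas_zpow a b f : Cmeas f -> Cmeas (fun x => zpow a b (f x)).
Proof.
move=> mf; rewrite /zpow.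
have mX g n : Cmeas g -> Cmeas (fun x => g x ^+ n).
  move=> mg; elim: n => [|n IH].
    have -> : (fun x => g x ^+ 0) = (fun=> 1) by apply/funext => x; rewrite expr0.
    by split; exact: measurable_cst.
  have -> : (fun x => g x ^+ n.+1) = (fun x => g x * g x ^+ n).
    by apply/funext => x; rewrite exprS.
  exact: CmeasM.
by apply: CmeasM; apply: mX => //; exact: CmeasJ.
Qed.

Lemma Cmeas_fejer_meanC N h : Cmeas (fejer_meanC N h).
Proof. by have [/integ_meas ? /integ_meas ?] := Cinteg_trig (index_enum _)
  (fun p : 'I_N * 'I_N => (N%:R^-1)%:C * fourier_coef h (freq p)) (@freq N). Qed.

Lemma normc_pow_le (z : R[i]) q :
  normc z ^+ q <= 2 ^+ q * (`|Re z| ^+ q + `|Im z| ^+ q).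
Proof.
pose m := Num.max `|Re z| `|Im z|.
have m0 : 0 <= m by rewrite le_max normr_ge0.
have zm : normc z <= 2 * m.
  have -> : z = (Re z)%:C + 0 +i* (Im z) by apply: complex_ext => /=; rewrite ?addr0 ?add0r.
  apply: le_trans (le_normcD _ _) _; rewrite normc_real.
  have -> : normc (0 +i* Im z) = `|Im z| by rewrite /= expr0n/= add0r sqrtr_sqr.
  by rewrite mulr2n mulrDl mul1r lerD// le_max lexx ?orbT.
apply: (@le_trans _ _ ((2 * m) ^+ q)).
  by rewrite lerXn2r ?nnegrE ?normc_ge0 ?mulr_ge0.
rewrite exprMn ler_wpM2l ?exprn_ge0// /m.
by case: (leP `|Re z| `|Im z|) => _; rewrite ?lerDl ?lerDr exprn_ge0.
Qed.

Lemma fejer_meanC_Lq q h : Cmeas h -> integ (fun x => normc (h x) ^+ q.+1) ->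
  [/\ Cinteg h,
    forall N, integ (fun x => normc (fejer_meanC N.+1 h x - h x) ^+ q.+1) &
    int_ (fun x => normc (fejer_meanC n.+1 h x - h x) ^+ q.+1) @[n --> \oo] --> 0].
Proof.
move=> mh ih; have [m1 m2] := mh.
have i1 : integ (fun x => `|Re (h x)| ^+ q.+1).
  apply: integ_le ih _ => [|x _]; first by apply: measurable_funX; apply: measurableT_comp.
  by rewrite ger0_norm ?exprn_ge0// lerXn2r ?nnegrE ?normc_ge0// normRe_le.
have i2 : integ (fun x => `|Im (h x)| ^+ q.+1).
  apply: integ_le ih _ => [|x _]; first by apply: measurable_funX; apply: measurableT_comp.
  by rewrite ger0_norm ?exprn_ge0// lerXn2r ?nnegrE ?normc_ge0// normIm_le.
have Ih : Cinteg h by split; [exact: integ_of_Lq i1|exact: integ_of_Lq i2].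
have [ir im] := Ih.
have iB (u : R -> R) (N : nat) : measurable_fun per u -> integ (fun x => `|u x| ^+ q.+1) ->
    integ (fun x => `|fejer_mean N.+1 u x - u x| ^+ q.+1).
  move=> meas_u iu; have iu1 := integ_of_Lq meas_u iu.
  have [j1 _] := fejer_mean_contraction (ltn0Sn N) iu1 iu.
  apply: integ_le (integZ (3 ^+ q.+1) (integD (integD j1 iu) iu)) _ => [|x _].
    by apply: measurable_powD => //; exact: measurable_fejer_mean.
  rewrite ger0_norm ?exprn_ge0//.
  have := norm_powD3 q (fejer_mean N.+1 u x) (- u x) 0; rewrite addr0 normrN normr0 expr0n/= addr0.
  move/le_trans; apply; rewrite ler_wpM2l ?exprn_ge0//.
  by rewrite lerDl exprn_ge0.
have j1 N := iB _ N m1 i1; have j2 N := iB _ N m2 i2.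
have le1 N x : normc (fejer_meanC N.+1 h x - h x) ^+ q.+1 <=
  2 ^+ q.+1 * (`|fejer_mean N.+1 (Re \o h) x - Re (h x)| ^+ q.+1
             + `|fejer_mean N.+1 (Im \o h) x - Im (h x)| ^+ q.+1).
  apply: le_trans (normc_pow_le _ _) _; rewrite fejer_meanCE//.
  by case: (h x) => a b.
have iD N : integ (fun x => normc (fejer_meanC N.+1 h x - h x) ^+ q.+1).
  apply: integ_le (integZ (2 ^+ q.+1) (integD (j1 N) (j2 N))) _ => [|x _].
    apply: measurable_funX; apply: measurable_normc.
    by apply: CmeasB => //; exact: Cmeas_fejer_meanC.
  by rewrite ger0_norm ?exprn_ge0 ?normc_ge0.
split => //.
have c1 := fejer_mean_Lq m1 i1; have c2 := fejer_mean_Lq m2 i2.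
have c3 : 2 ^+ q.+1 * (int_ (fun x => `|fejer_mean n.+1 (Re \o h) x - Re (h x)| ^+ q.+1)
  + int_ (fun x => `|fejer_mean n.+1 (Im \o h) x - Im (h x)| ^+ q.+1)) @[n --> \oo] --> 0.
  have -> : 0 = 2 ^+ q.+1 * (0 + 0) :> R by rewrite addr0 mulr0.
  by apply: cvgMr; exact: cvgD.
apply/cvgrPdist_le => e e0; have := cvg0_le c3 e0; apply: filterS => n.
rewrite sub0r normrN; apply: le_trans.
rewrite ger0_norm; last by apply: int_ge0 => x _; rewrite exprn_ge0 ?normc_ge0.
apply: le_trans (ler_norm _); rewrite -intD// -intZ; last exact: integD.
by apply: le_int => //; apply: integZ; exact: integD.
Qed.

Lemma Re_fourier_coef_le g n : Cinteg g -> integ (fun x => normc (g x)) ->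
  `|Re (fourier_coef g n)| <= (2 * pi)^-1 * int_ (fun x => normc (g x)).
Proof.
move=> gi gn; have [gi' _] := CintegMechar (- n) gi.
rewrite fourier_coefE cReM/= mul0r subr0 normrM [X in X * _]ger0_norm ?invr_ge0 ?(ltW pi2_gt0)//.
rewrite ler_wpM2l ?invr_ge0 ?(ltW pi2_gt0)//.
apply: le_trans (le_norm_int gi') _; apply: le_int => //; first exact: integ_norm.
move=> x _ /=; apply: le_trans (normRe_le _) _.
by rewrite Normc.normcM normc_echar mulr1.
Qed.

(** With [poly_lip_split], the L^1 distance between the images is at most
    d ||1 + |h| ||^(q+1) + A_d ||P_n - h||^(q+1) for the norm of L^(q+1), where
    P_n are the Fejer means; choose d first, then n. *)
Lemma fourier_coef_zpow_cvg a b q h m : Cmeas h -> integ (fun x => normc (h x) ^+ q.+1) ->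
  (a + b <= q)%N ->
  Re (fourier_coef (fun x => zpow a b (fejer_meanC n.+1 h x)) m) @[n --> \oo] -->
  Re (fourier_coef (fun x => zpow a b (h x)) m).
Proof.
move=> mh ih abq; have [Ih iD cD] := fejer_meanC_Lq mh ih.
have lipab := poly_lip_zpow a b.
have i1 : integ (fun x => (1 + normc (h x)) ^+ q.+1).
  apply: integ_le (integZ (2 ^+ q.+1) (integD (integ_cst 1) ih)) _ => [|x _].
    apply: measurable_funX; apply: measurable_funD; first exact: measurable_cst.
    exact: measurable_normc.
  have n0 := normc_ge0 (h x).
  rewrite ger0_norm ?exprn_ge0 ?addr_ge0//.
  apply: (@le_trans _ _ ((2 * Num.max 1 (normc (h x))) ^+ q.+1)).
    rewrite lerXn2r ?nnegrE ?addr_ge0 ?mulr_ge0 ?le_max ?ler01//.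
    by rewrite mulr2n mulrDl mul1r lerD// le_max lexx ?orbT.
  rewrite exprMn ler_wpM2l ?exprn_ge0//.
  by case: (leP 1 (normc (h x))) => _; rewrite ?expr1n ?lerDl ?lerDr// exprn_ge0.
have bnd n d : 0 < d -> exists2 A : R, 0 <= A & forall x,
   normc (zpow a b (fejer_meanC n.+1 h x) - zpow a b (h x)) <=
   d * (1 + normc (h x)) ^+ q.+1 + A * normc (fejer_meanC n.+1 h x - h x) ^+ q.+1.
  move=> d0; have [A A0 hA] := poly_lip_split lipab abq d0.
  by exists A.
have mZ g : Cmeas g -> Cmeas (fun x => zpow a b (g x)) by exact: Cmeas_zpow.
pose D n x := zpow a b (fejer_meanC n.+1 h x) - zpow a b (h x).
have mD n : Cmeas (D n).
  by apply: CmeasB; [apply: mZ; exact: Cmeas_fejer_meanC|exact: mZ].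
have inD n : integ (fun x => normc (D n x)).
  have [A A0 hA] := bnd n 1 ltr01.
  apply: integ_le (integD (integZ 1 i1) (integZ A (iD n))) _ => [|x _].
    exact: measurable_normc.
  by rewrite ger0_norm ?normc_ge0//; exact: hA.
have iZ : Cinteg (fun x => zpow a b (h x)).
  apply: CintegP; first exact: mZ.
  apply: integ_le i1 _ => [|x _]; first exact: measurable_normc (mZ _ mh).
  rewrite ger0_norm ?normc_ge0//.
  have M1 : 1 <= 1 + normc (h x) by rewrite lerDl normc_ge0.
  have hM : normc (h x) <= 1 + normc (h x) by rewrite lerDr.
  have [H _] := lipab (h x) (h x) _ M1 hM hM.
  by apply: le_trans H _; rewrite ler_weXn2l// (leq_trans abq).
have iDc n : Cinteg (D n) by apply: CintegP.
apply/cvgrPdist_le => e e0.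
pose I1 := int_ (fun x => (1 + normc (h x)) ^+ q.+1).
have I10 : 0 <= I1 by apply: int_ge0 => x _; rewrite exprn_ge0// addr_ge0// normc_ge0.
pose e' := 2 * pi * e; have e'0 : 0 < e' by rewrite mulr_gt0 ?pi2_gt0.
pose d := e' / 2 / (I1 + 1).
have d0 : 0 < d by rewrite !divr_gt0// ltr_wpDl.
have [A A0 hA] := poly_lip_split lipab abq d0.
have e''0 : 0 < e' / 2 / (A + 1) by rewrite !divr_gt0// ltr_wpDl.
have := cvg0_le cD e''0; apply: filterS => n.
rewrite ger0_norm; last by apply: int_ge0 => x _; rewrite exprn_ge0 ?normc_ge0.
move=> hIn; set In := int_ (fun x => normc (fejer_meanC n.+1 h x - h x) ^+ q.+1) in hIn.
have -> : Re (fourier_coef (fun x => zpow a b (h x)) m) -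
    Re (fourier_coef (fun x => zpow a b (fejer_meanC n.+1 h x)) m) = - Re (fourier_coef (D n) m).
  have -> : (fun x => zpow a b (fejer_meanC n.+1 h x)) = (fun x => zpow a b (h x) + D n x).
    by apply/funext => x; rewrite /D addrC subrK.
  by rewrite fourier_coefD// cReD; ring.
rewrite normrN; apply: le_trans (Re_fourier_coef_le m (iDc n) (inD n)) _.
rewrite ler_pdivrMl ?pi2_gt0// -/e'.
have iR := integD (integZ d i1) (integZ A (iD n)).
apply: le_trans (le_int (inD n) iR _) _.
  by move=> x _; exact: hA.
rewrite intD; [|exact: integZ|exact: integZ].
rewrite !intZ// -/I1 -/In.
have In0 : 0 <= In by apply: int_ge0 => x _; rewrite exprn_ge0 ?normc_ge0.
have : d * I1 <= e' / 2.
  by rewrite /d mulrAC ler_pdivrMr ?ltr_wpDl// ler_wpM2l ?lerDl// divr_ge0// ltW.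
have : A * In <= e' / 2.
  move: hIn; rewrite ler_pdivlMr ?ltr_wpDl// => hIn; apply: le_trans hIn.
  by rewrite mulrC ler_wpM2l// lerDl.
lra.
Qed.

End power_maps.

(** * Trigonometric polynomials with nonnegative coefficients *)

Section positive_trig.
Context {R : realType}.
Local Notation Re := (@complex.Re R).
Local Notation Im := (@complex.Im R).
Local Notation normc := (@Normc.normc R).
Implicit Types (A B : set int) (g h : R -> R[i]).

(** Coefficients equal to 0 are allowed outside A, which spares the removal of
    vanishing coefficients from sums such as Fejer means. *)
Definition postrig A g := exists2 s : seq (R[i] * int),
  forall t, t \in s -> 0 <= t.1 /\ (t.1 != 0 -> A t.2) &
  forall x, g x = \sum_(t <- s) t.1 * echar t.2 x.

Lemma postrig_sub A B g : A `<=` B -> postrig A g -> postrig B g.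
Proof. by move=> AB [s sA gE]; exists s => // t /sA[? h]; split => // /h /AB. Qed.

Lemma postrig_eq A g h : (forall x, g x = h x) -> postrig A g -> postrig A h.
Proof. by move=> gh [s sA gE]; exists s => // x; rewrite -gh. Qed.

Lemma postrig_echar A n (c : R[i]) : 0 <= c -> (c != 0 -> A n) ->
  postrig A (fun x => c * echar n x).
Proof.
move=> c0 cA; exists [:: (c, n)] => [t|x]; last by rewrite big_seq1.
by rewrite inE => /eqP ->.
Qed.

Lemma postrigD A g h : postrig A g -> postrig A h -> postrig A (fun x => g x + h x).
Proof.
move=> [s sA gE] [s' sA' hE]; exists (s ++ s') => [t|x].
  by rewrite mem_cat => /orP[/sA|/sA'].
by rewrite big_cat /= gE hE.
Qed.

Lemma postrigM A B g h : postrig A g -> postrig B h ->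
  postrig [set a + b | a in A & b in B] (fun x => g x * h x).
Proof.
move=> [s sA gE] [s' sB hE].
exists [seq (t.1 * t'.1, t.2 + t'.2) | t <- s, t' <- s'] => [t|x].
  move=> /allpairsP[[u v] /= [/sA[u0 uA] /sB[v0 vB] ->]]; split; first exact: mulr_ge0.
  rewrite mulf_eq0 negb_or => /andP[/uA ? /vB ?].
  by exists u.2 => //; exists v.2.
rewrite gE hE big_allpairs_dep/= big_distrlr/=.
by apply: eq_bigr => t _; apply: eq_bigr => t' _; rewrite echarD; ring.
Qed.

Lemma postrigJ A g : postrig A g -> postrig [set - a | a in A] (fun x => conjc (g x)).
Proof.
move=> [s sA gE]; exists [seq (t.1, - t.2) | t <- s] => [t|x].
  move=> /mapP[u /sA[u0 uA] ->]; split => //= /uA ?; by exists u.2.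
rewrite gE rmorph_sum/= big_map big_seq [RHS]big_seq; apply: eq_bigr => t /sA[t0 _].
rewrite rmorphM/= echarN; congr (_ * _).
by move: t0; rewrite lecE /= => /andP[/eqP im0 _]; case: (t.1) im0 => a b /= ->; rewrite oppr0.
Qed.

Lemma postrig_coef_ge0 A g n : postrig A g -> 0 <= fourier_coef g n.
Proof.
move=> [s sA gE]; have -> : g = (fun x => \sum_(t <- s) t.1 * echar t.2 x) by exact/funext.
rewrite (fourier_coef_trig s (fun t => t.1) (fun t => t.2)) big_seq_cond.
by apply: sumr_ge0 => t /andP[/sA[]].
Qed.

Lemma postrig_coef_eq0 A g n : postrig A g -> ~ A n -> fourier_coef g n = 0.
Proof.
move=> [s sA gE] An; have -> : g = (fun x => \sum_(t <- s) t.1 * echar t.2 x) by exact/funext.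
rewrite (fourier_coef_trig s (fun t => t.1) (fun t => t.2)) big_seq_cond big1// => t /andP[/sA[_ tA] /eqP tn].
by apply/eqP; apply/negPn/negP => /tA; rewrite tn.
Qed.

Lemma postrig_integ A g : postrig A g -> Cinteg g.
Proof.
move=> [s sA gE]; have -> : g = (fun x => \sum_(t <- s) t.1 * echar t.2 x) by exact/funext.
exact: Cinteg_trig.
Qed.

(** Coefficientwise inequality between two trigonometric polynomials with
    nonnegative coefficients. *)
Definition dominates g h := postrig setT (fun x => g x - h x) /\ postrig setT h.

Lemma dominates_postrig g h : dominates g h -> postrig setT g.
Proof.
by move=> [a b]; apply: postrig_eq (postrigD a b) => x; rewrite subrK.
Qed.

(** gg' - hh' = g (g' - h') + (g - h) h'. *)
Lemma dominatesM g h g' h' : dominates g h -> dominates g' h' ->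
  dominates (fun x => g x * g' x) (fun x => h x * h' x).
Proof.
move=> gh gh'; have [a b] := gh; have [a' b'] := gh'.
have pg := dominates_postrig gh.
split; last by apply: postrig_sub (postrigM b b').
have := postrigD (postrig_sub (@subsetT _ _) (postrigM pg a'))
  (postrig_sub (@subsetT _ _) (postrigM a b')).
by apply: postrig_eq => x; ring.
Qed.

Lemma dominatesJ g h : dominates g h ->
  dominates (fun x => conjc (g x)) (fun x => conjc (h x)).
Proof.
move=> [a b]; split; last exact: postrig_sub (postrigJ b).
by apply: postrig_eq (postrig_sub (@subsetT _ _) (postrigJ a)) => x; rewrite rmorphB.
Qed.

Lemma dominates1 : dominates (fun=> 1) (fun=> 1).
Proof.
have p1 (c : R[i]) : 0 <= c -> postrig setT (fun=> c : R[i]).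
  move=> c0; apply: (@postrig_eq _ (fun x => c * echar 0 x)) => [x|].
    by rewrite echar0 mulr1.
  exact: postrig_echar.
by split; [rewrite subrr; apply: p1|apply: p1; exact: ler01].
Qed.

Lemma dominatesX g h n : dominates g h ->
  dominates (fun x => g x ^+ n) (fun x => h x ^+ n).
Proof.
move=> gh; elim: n => [|n IH].
  have e k : (fun x => k x ^+ 0) = (fun=> 1) :> (R -> R[i]).
    by apply/funext => x; rewrite expr0.
  by rewrite !e; exact: dominates1.
have e k : (fun x => k x ^+ n.+1) = (fun x : R => k x * k x ^+ n) :> (R -> R[i]).
  by apply/funext => x; rewrite exprS.
by rewrite !e; exact: dominatesM.
Qed.

Lemma dominates_zpow a b g h : dominates g h ->
  dominates (fun x => zpow a b (g x)) (fun x => zpow a b (h x)).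
Proof. by move=> gh; apply: dominatesM; apply: dominatesX => //; exact: dominatesJ. Qed.

Lemma dominates_coef g h n : dominates g h ->
  Re (fourier_coef h n) <= Re (fourier_coef g n).
Proof.
move=> gh; have [a b] := gh.
have -> : g = (fun x => h x + (g x - h x)) by apply/funext => x; rewrite addrC subrK.
rewrite fourier_coefD; [|exact: postrig_integ b|exact: postrig_integ a].
rewrite cReD lerDl; have := postrig_coef_ge0 n a.
by rewrite lecE => /andP[].
Qed.

(** Dropping all frequencies but one can only decrease coefficients. *)
Lemma dominates_single A g n : postrig A g ->
  dominates g (fun x => fourier_coef g n * echar n x).
Proof.
move=> pg; split; last first.
  by apply: postrig_echar => //; exact: postrig_coef_ge0 pg.
have [s sA gE] := pg.
exists [seq t <- s | t.2 != n] => [t|x].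
  by rewrite mem_filter => /andP[_ /sA[]].
have -> : fourier_coef g n * echar n x = \sum_(t <- s | t.2 == n) t.1 * echar t.2 x.
  have -> : g = (fun x => \sum_(t <- s) t.1 * echar t.2 x) by exact/funext.
  rewrite (fourier_coef_trig s (fun t => t.1) (fun t => t.2)) mulr_suml.
  by apply: eq_bigr => t /eqP ->.
by rewrite gE big_filter (bigID (fun t => t.2 == n))/= addrAC subrr add0r.
Qed.

(** The frequency is (i+1) n - i n = n. *)
Lemma zpow_single i (c : R[i]) n x : 0 <= c ->
  zpow i.+1 i (c * echar n x) = c ^+ (2 * i).+1 * echar n x.
Proof.
move=> c0; rewrite /zpow rmorphM/=.
have -> : conjc c = c.
  by move: c0; rewrite lecE /= => /andP[/eqP + _]; case: c => a b /= ->; rewrite oppr0.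
have e1 : echar n x * conjc (echar n x) = 1.
  by rewrite -normc_sqr normc_echar expr1n.
rewrite exprS !exprMn mulSn -/(_ ^+ _).
have -> : c * echar n x * (c ^+ i * echar n x ^+ i) * (c ^+ i * conjc (echar n x) ^+ i)
  = c * (c ^+ i * c ^+ i) * echar n x * (echar n x * conjc (echar n x)) ^+ i.
  by rewrite exprMn; ring.
by rewrite e1 expr1n mulr1 exprS mul1n exprD.
Qed.

(** In the convolution formula for the n-th coefficient of g^(i+1) conj(g)^i all
    terms are nonnegative; keep the one in which every frequency is n. *)
Lemma postrig_coef_zpow A g i n : postrig A g ->
  Re (fourier_coef g n) ^+ (2 * i).+1 <= Re (fourier_coef (fun x => zpow i.+1 i (g x)) n).
Proof.
move=> pg; have c0 := postrig_coef_ge0 n pg.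
apply: le_trans (dominates_coef n (dominates_zpow i.+1 i (dominates_single n pg))).
have -> : (fun x => zpow i.+1 i (fourier_coef g n * echar n x)) =
  (fun x => fourier_coef g n ^+ (2 * i).+1 * echar n x).
  by apply/funext => x; exact: zpow_single.
rewrite fourier_coefZ ?fourier_coef_echar ?eqxx ?mulr1; last exact: Cinteg_echar.
have -> : fourier_coef g n = (Re (fourier_coef g n))%:C.
  by move: c0; rewrite lecE => /andP[/eqP]; case: (fourier_coef g n) => a b /= ->.
by rewrite -rmorphXn.
Qed.

Lemma sum_diff_set00 A : sum_diff_set A 0 0 0.
Proof.
exists (fun=> 0), (fun=> 0); split; [by case|by case|].
by rewrite !big_ord0 subrr.
Qed.

Lemma sum_diff_setSl A a b n x : A x -> sum_diff_set A a b n ->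
  sum_diff_set A a.+1 b (x + n).
Proof.
move=> Ax [s [t [sA tA ->]]].
exists (fun i => oapp s x (unlift ord0 i)), t; split => //.
  by move=> i; case: unliftP => [j|] _ /=.
rewrite big_ord_recl unlift_none /= addrA; congr (_ + _ - _).
by apply: eq_bigr => i _; rewrite liftK.
Qed.

Lemma sum_diff_setSr A a b n x : A x -> sum_diff_set A a b n ->
  sum_diff_set A a b.+1 (- x + n).
Proof.
move=> Ax [s [t [sA tA ->]]].
exists s, (fun i => oapp t x (unlift ord0 i)); split => //.
  by move=> i; case: unliftP => [j|] _ /=.
rewrite big_ord_recl unlift_none /= opprD addrCA; congr (_ + (_ - _)).
by apply: eq_bigr => i _; rewrite liftK.
Qed.

Lemma postrig_zpow A a b g : postrig A g ->
  postrig (sum_diff_set A a b) (fun x => zpow a b (g x)).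
Proof.
move=> pg; elim: a => [|a IH]; last first.
  apply: postrig_eq (postrig_sub _ (postrigM pg IH)) => [x|_ [y Ay] [n nA <-]].
    by rewrite /zpow exprS mulrA.
  exact: sum_diff_setSl.
elim: b => [|b IH].
  apply: (@postrig_eq _ (fun x => 1 * echar 0 x)) => [x|].
    by rewrite echar0 /zpow !expr0.
  by apply: postrig_echar => [|_]; [exact: ler01|exact: sum_diff_set00].
apply: postrig_eq (postrig_sub _ (postrigM (postrigJ pg) IH)) => [x|_ [_ [y Ay <-]] [n nA <-]].
  by rewrite /zpow expr0 !mul1r exprS.
exact: sum_diff_setSr.
Qed.

Lemma postrig_fejer_meanC N h : (forall n, 0 <= fourier_coef h n) ->
  postrig (frequencies h) (fejer_meanC N h).
Proof.
move=> h0; exists [seq ((N%:R^-1)%:C * fourier_coef h (freq p), freq p) | p <- index_enum ('I_N * 'I_N)%type].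
  move=> t /mapP[p _ ->] /=; split.
    by rewrite mulr_ge0// ler0c invr_ge0.
  by rewrite mulf_eq0 negb_or => /andP[].
by move=> x; rewrite big_map.
Qed.

End positive_trig.

(** * Frequencies of minimal majorants *)

Section minimal_majorants.
Context {R : realType}.
Local Notation Re := (@complex.Re R).
Local Notation Im := (@complex.Im R).
Local Notation normc := (@Normc.normc R).
Implicit Types (f F : R -> R[i]).

(** The exponent 2j/(2j-1) for j = i + 1. *)
Definition dual_exponent i : R := (2 * i.+1)%:R / (2 * i.+1 - 1)%:R.

Lemma dual_exponent_denom i : (2 * i.+1 - 1)%N = (2 * i).+1.
Proof. lia. Qed.

Lemma dual_exponent_gt1 i : 1 < dual_exponent i.
Proof. by rewrite /dual_exponent dual_exponent_denom ltr_pdivlMr ?ltr0n// mul1r ltr_nat; lia. Qed.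

(** For z <> 0 the factors |z|^(p-2) contribute |z|^((p-2)(2i+1)) = |z|^(-2i),
    which cancels (z conj z)^i. *)
Lemma zpow_dual i (z : R[i]) : zpow i.+1 i (dual_elt (dual_exponent i) z) = z.
Proof.
have [->|z0] := eqVneq z 0.
  by rewrite /dual_elt mulr0 /zpow exprS !mul0r.
have nz : 0 < normc z.
  by rewrite lt_neqAle normc_ge0 andbT eq_sym; apply: contraNneq z0 => /Normc.eq0_normc ->.
rewrite /dual_elt; set r := _ `^ _.
have rE : r ^+ (2 * i).+1 * normc z ^+ (2 * i) = 1.
  rewrite -powR_mulrn ?powR_ge0// -powRrM -[X in _ * X]powR_mulrn ?normc_ge0//.
  rewrite -powRD; last by rewrite (gt_eqF nz) implybT.
  rewrite (_ : _ + _ = 0) ?powRr0//.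
  have i0 : 0 <= i%:R :> R by [].
  have d0 : 2 * i%:R + 1 != 0 :> R by apply: lt0r_neq0; lra.
  by rewrite /dual_exponent dual_exponent_denom -[(2 * i).+1]addn1 -[i.+1]addn1 natrM natrD natrM natrD natrM; field.
have -> : zpow i.+1 i (r%:C * z) = (r ^+ (2 * i).+1)%:C * (z * conjc z) ^+ i * z.
  rewrite /zpow conjcZ rmorphXn/= !exprMn.
  by rewrite ![_ ^+ _.+1]exprS mul2n -addnn exprD; ring.
by rewrite -normc_sqr -rmorphXn -exprM -rmorphM/= rE mul1r.
Qed.

(** The frequencies of K lie among those of f because a frequency n of K
    outside them would make F^(n) > 0 = |f^(n)|, and then K^(n) = 0 by
    [dual_coef_eq0]. *)
Theorem frequencies_minimal_majorant i f F :
  minimal_majorant (dual_exponent i) f F ->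
  frequencies F `<=` sum_diff_set (frequencies f) i.+1 i.
Proof.
move=> Fmin; have p1 := dual_exponent_gt1 i; have p0 := lt_trans ltr01 p1.
have [/(in_LpP _ p0)[mF iF] fF _] := Fmin.
have /majorantP fF' := fF.
pose K x := dual_elt (dual_exponent i) (F x).
have mK : Cmeas K by exact: Cmeas_dual.
have iK : integ (fun x => normc (K x) ^+ (2 * i).+2).
  apply: eq_integ iF => x _; rewrite normc_dual// -powR_mulrn ?powR_ge0// -powRrM.
  congr (_ `^ _).
  have i0' : 0 <= i%:R :> R by [].
  have d0 : 2 * i%:R + 1 != 0 :> R by apply: lt0r_neq0; lra.
  rewrite /dual_exponent dual_exponent_denom -[(2 * i).+2]addn2 -[(2 * i).+1]addn1 -[i.+1]addn1.
  by rewrite !(natrM, natrD); field.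
have FK : (fun x => zpow i.+1 i (K x)) = F.
  by apply/funext => x; exact: zpow_dual.
have K0 n : 0 <= fourier_coef K n.
  rewrite lecE /= (dual_coef_ge0 n p1 Fmin) andbT; apply/eqP.
  by apply: dual_coef_real => // m; have [] := fF' m.
have pP N : postrig (frequencies K) (fejer_meanC N K) by exact: postrig_fejer_meanC.
(* The identity map is the case a = 1, b = 0 of z^a conj(z)^b. *)
have cK n : Re (fourier_coef (fejer_meanC N.+1 K) n) @[N --> \oo] --> Re (fourier_coef K n).
  have := @fourier_coef_zpow_cvg R 1 0 _ K n mK iK isT.
  have e (h : R -> R[i]) : (fun x => zpow 1 0 (h x)) = h.
    by apply/funext => x; rewrite /zpow expr0 expr1 mulr1.
  by rewrite e; under eq_fun do rewrite e.
have cF n : Re (fourier_coef (fun x => zpow i.+1 i (fejer_meanC N.+1 K x)) n) @[N --> \oo]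
    --> Re (fourier_coef F n).
  (* K lies in L^(2i+2), and K^(i+1) conj(K)^i has degree 2i+1. *)
have le_q : (i.+1 + i <= (2 * i).+1)%N by lia.
  by have := @fourier_coef_zpow_cvg R _ _ _ K n mK iK le_q; rewrite FK.
have Fge n : Re (fourier_coef K n) ^+ (2 * i).+1 <= Re (fourier_coef F n).
  have cX : Re (fourier_coef (fejer_meanC N.+1 K) n) ^+ (2 * i).+1 @[N --> \oo] -->
      Re (fourier_coef K n) ^+ (2 * i).+1.
    apply: (cvg_comp _ (fun y : R => y ^+ (2 * i).+1) (cK n)).
    exact: exprn_continuous.
  apply: (ler_cvg_to cX (cF n)); apply: nearW => N.
  exact: postrig_coef_zpow (pP _).
have KS : frequencies K `<=` frequencies f.
  move=> n /= Kn; apply/negP => /eqP fn.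
  have Kn0 : 0 < Re (fourier_coef K n).
    have := K0 n; rewrite le_eqVlt eq_sym (negbTE Kn) /= ltcE /=.
    by move=> /andP[].
  have : normc (fourier_coef f n) < Re (fourier_coef F n).
    by rewrite fn Normc.normc0; apply: lt_le_trans (Fge n); rewrite exprn_gt0.
  by move=> /(dual_coef_eq0 p1 Fmin) K0'; move: Kn0; rewrite K0' ltxx.
move=> n /= Fn; apply: contrapT => nS; move/negP: Fn; apply.
have [Fn0 _] := fF' n.
suff Fr : Re (fourier_coef F n) = 0.
  by apply/eqP; apply: complex_ext; [rewrite Fr|rewrite Fn0].
have := cF n.
have -> : (fun N => Re (fourier_coef (fun x => zpow i.+1 i (fejer_meanC N.+1 K x)) n)) = fun=> 0.
  apply/funext => N; have pz := postrig_zpow i.+1 i (postrig_sub KS (pP N.+1)).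
  by rewrite (postrig_coef_eq0 pz nS).
by move=> /(cvg_unique _ (cvg_cst _)) e; exact: (esym (e _)).
Qed.

Lemma sum_diff_set_bound (S : set int) a b (M : int) n :
  (forall m, S m -> `|m| <= M) -> sum_diff_set S a b n -> `|n| <= (a + b)%:R * M.
Proof.
move=> SM [s [t [sS tS ->]]]; apply: le_trans (ler_normB _ _) _.
rewrite natrD mulrDl; apply: lerD.
  apply: le_trans (ler_norm_sum _ _ _) _.
  apply: le_trans (ler_sum _ (fun k _ => SM _ (sS k))) _.
  by rewrite sumr_const card_ord mulr_natl.
apply: le_trans (ler_norm_sum _ _ _) _.
apply: le_trans (ler_sum _ (fun k _ => SM _ (tS k))) _.
by rewrite sumr_const card_ord mulr_natl.
Qed.

Lemma int_interval_finite (M : nat) :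
  exists s : seq int, forall n : int, `|n| <= M%:Z -> n \in s.
Proof.
exists [seq k%:Z - M%:Z | k <- iota 0 (2 * M).+1] => n nM.
apply/mapP; exists (absz (n + M%:Z)); last by lia.
by rewrite mem_iota; lia.
Qed.

Lemma seq_int_bound (s : seq int) : exists M : nat, forall n, n \in s -> `|n| <= M%:Z.
Proof.
elim: s => [|m s [M IH]]; first by exists 0%N.
exists (absz m + M)%N => n; rewrite inE => /predU1P[->|/IH]; lia.
Qed.

(** A bounded set of frequencies has bounded sums. *)
Theorem minimal_majorant_trig i f F : in_Lp (dual_exponent i) f ->
  minimal_majorant (dual_exponent i) f F -> trig_polynomial f -> trig_polynomial F.
Proof.
move=> fp Fmin ft; have p1 := dual_exponent_gt1 i; have p0 := lt_trans ltr01 p1.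
have /(in_LpP _ p0)[mf iff] := fp.
have [/(in_LpP _ p0)[mF iF] _ _] := Fmin.
have [s fs] := trig_finite_frequencies (Lp_L1 p1 mf iff) ft.
have [M sM] := seq_int_bound s.
have [r rP] := int_interval_finite ((i.+1 + i) * M).
apply: (finite_frequencies_trig (s := r)); first exact: Lp_L1 p1 mF iF.
move=> n Fn; apply: rP; rewrite PoszM -natz.
apply: (sum_diff_set_bound _ (frequencies_minimal_majorant Fmin Fn)).
by move=> m /fs/sM.
Qed.

End minimal_majorants.

Theorem corollary1p2 (R : realType) (j : nat) (f F : R -> R[i]) :
  (1 < j)%N ->
  in_Lp ((2 * j)%:R / (2 * j - 1)%:R) f ->
  minimal_majorant ((2 * j)%:R / (2 * j - 1)%:R) f F ->
  frequencies F `<=` sum_diff_set (frequencies f) j (j - 1) /\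
  (trig_polynomial f -> trig_polynomial F).
Proof.
case: j => [//|i]; rewrite ltnS => _ fp Fmin; rewrite subn1 /=.
split; first exact: frequencies_minimal_majorant.
exact: minimal_majorant_trig fp Fmin.
Qed.
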